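(* Let $(X,G)$ be a $G$-action topological dynamical system, where $G$ is a countable infinite discrete amenable group. Let $\{F_n\}$ be a sequence of finite subsets of $G$ satisfying the growth condition $\lim_{n\to+\infty}\frac{|F_n|}{\log n}=+\infty$. Then for any non-empty Borel subset $Z$ of $X$, $$h^P_{top}(Z,\{F_n\})=\sup\{\overline h_{\mu}^{loc}(Z,\{F_n\}):\mu\in M(X),\ \mu(Z)=1\}.$$
   Context: $(X,G)$ being a $G$-action topological dynamical system means that $X$ is a compact metric space with metric $d$ and the (discrete) group $G$ acts continuously on $X$. $M(X)$ is the set of Borel probability measures on $X$. The sequence $\{F_n\}$ is not assumed to be a F{\o}lner sequence. For a finite subset $F\subset G$ put $d_F(x,y)=\max_{g\in F}d(gx,gy)$, and for $\varepsilon>0$ let $B_F(x,\varepsilon)=\{y\in X:d_F(x,y)<\varepsilon\}$ and $\overline B_F(x,\varepsilon)=\{y\in X:d_F(x,y)\le\varepsilon\}$. Packing entropy. For $Z\subseteq X$, $s\ge 0$, $N\in\mathbb N$, $\varepsilon>0$, let $P(Z,N,\varepsilon,s,\{F_n\})=\sup\sum_i\exp(-s|F_{n_i}|)$, the supremum over all finite or countable pairwise disjoint families $\{\overline B_{F_{n_i}}(x_i,\varepsilon)\}$ with $x_i\in Z$ and $n_i\ge N$ for all $i$. Let $P(Z,\varepsilon,s,\{F_n\})=\lim_{N\to+\infty}P(Z,N,\varepsilon,s,\{F_n\})$ and $$\mathcal P(Z,\varepsilon,s,\{F_n\})=\inf\Big\{\sum_{i=1}^{+\infty}P(Z_i,\varepsilon,s,\{F_n\}):\bigcup_{i=1}^{+\infty}Z_i\supseteq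 Z\Big\}.$$ $h^P_{top}(Z,\varepsilon,\{F_n\})\in[0,+\infty]$ is the critical value of $s$ at which $\mathcal P(Z,\varepsilon,s,\{F_n\})$ jumps from $+\infty$ to $0$ (it is $0$ for $s$ larger than the critical value and $+\infty$ for $s$ smaller). The packing topological entropy of $Z$ is $h^P_{top}(Z,\{F_n\})=\lim_{\varepsilon\to0}h^P_{top}(Z,\varepsilon,\{F_n\})$. Upper local entropy. For $\mu\in M(X)$ and a Borel set $Z\subseteq X$, $$\overline h_{\mu}^{loc}(Z,\{F_n\})=\int_Z\lim_{\varepsilon\to 0}\limsup_{n\to+\infty}-\frac{1}{|F_n|}\log\mu(B_{F_n}(x,\varepsilon))\,d\mu(x).$$ *)

(* Defs.v *)
From HB Require Import structures.
From mathcomp Require Import all_boot all_order all_algebra finmap.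
From mathcomp Require Import all_classical all_reals all_analysis.

Set Implicit Arguments.
Unset Strict Implicit.
Unset Printing Implicit Defensive.

Import Order.TTheory GRing.Theory Num.Theory.
Import numFieldNormedType.Exports.

Local Open Scope classical_set_scope.
Local Open Scope ring_scope.

(* A [measurableType] must be pointed, so the Borel sigma-algebra is only
   available over a pointed carrier: this is a nonempty metric space. *)
#[short(type="pmetricType")]
HB.structure Definition PMetric (R : numDomainType) :=
  {T of Pointed T & Metric R T}.

Definition continuous_action (G : groupType) (X : topologicalType)
    (act : G -> X -> X) : Prop :=
  [/\ forall x, act 1%g x = x,
      forall g h x, act (g * h)%g x = act g (act h x)
    & forall g, continuous (act g)].

(* Amenability of a countable discrete group: existence of a Folner sequence. *)
Definition amenable (R : realType) (G : groupType) : Prop :=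
  exists K : nat -> {fset G},
    (forall n, K n != fset0) /\
    forall g : G,
      (fun n => let gK := [fset (g * h)%g | h in K n]%fset in
        #|` ((gK `\` K n) `|` (K n `\` gK))%fset |%:R / #|` K n|%:R : R)
        @ \oo --> (0 : R).

Section Entropy.
Context {R : realType} {X : pmetricType R} {G : groupType}.

Definition borelType : measurableType _ := g_sigma_algebraType (@open X).

Definition borel (Z : set X) : Prop := measurable (Z : set borelType).

Definition growth_condition (F : nat -> {fset G}) : Prop :=
  (fun n => #|` F n|%:R / ln n%:R : R) @ \oo --> +oo.

Variables (act : G -> X -> X).

Definition bowen_dist (A : {fset G}) (x y : X) : R :=
  \big[Num.max/0]_(g <- A) mdist (act g x) (act g y).

Definition bowen_ball (A : {fset G}) (x : X) (e : R) : set X :=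
  [set y | bowen_dist A x y < e].

Definition bowen_cball (A : {fset G}) (x : X) (e : R) : set X :=
  [set y | bowen_dist A x y <= e].

Variable (F : nat -> {fset G}).

(* A finite or countable family indexed by a set I of natural numbers. *)
Definition packing_family (Z : set X) (N : nat) (e : R)
    (I : set nat) (x : nat -> X) (n : nat -> nat) : Prop :=
  [/\ forall i, I i -> Z (x i),
      forall i, I i -> (N <= n i)%N
    & trivIset I (fun i => bowen_cball (F (n i)) (x i) e)].

Definition packing_sum (s : R) (I : set nat) (n : nat -> nat) : \bar R :=
  \esum_(i in I) (expR (- s * #|` F (n i)|%:R))%:E.

Definition packing_N (Z : set X) (N : nat) (e s : R) : \bar R :=
  ereal_sup [set S | exists I x n,
    packing_family Z N e I x n /\ S = packing_sum s I n].

Definition packing_pre (Z : set X) (e s : R) : \bar R :=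
  limn (fun N => packing_N Z N e s).

Definition packing_measure (Z : set X) (e s : R) : \bar R :=
  ereal_inf [set (\sum_(i <oo) packing_pre (Zs i) e s)%E |
    Zs in [set Zs : (set X)^nat | Z `<=` \bigcup_i Zs i]].

(* The critical value of s >= 0, see [packing_measure_gt] and
   [packing_measure_lt]. *)
Definition packing_entropy_at (Z : set X) (e : R) : \bar R :=
  ereal_inf [set s%:E | s in
    [set s : R | 0 <= s /\ packing_measure Z e s = 0%E]].

Definition packing_entropy (Z : set X) : \bar R :=
  lim (packing_entropy_at Z e @[e --> 0^'+]).

(* [lne 0 = -oo], so this is +oo at x when small balls around x have measure
   zero along infinitely many n. *)
Definition upper_local_entropy_at (mu : probability borelType R) (x : X) :
    \bar R :=
  lim (limn_esup (fun n => - ((#|` F n|%:R^-1)%:E *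
         lne (mu (bowen_ball (F n) x e))))%E @[e --> 0^'+]).

Definition upper_local_entropy (mu : probability borelType R) (Z : set X) :
    \bar R :=
  (\int[mu]_(x in Z) upper_local_entropy_at mu x)%E.

Lemma packing_sum_le s t (c : R) I n : 0 <= c ->
    (forall i, I i -> expR (- t * #|` F (n i)|%:R) <=
                      c * expR (- s * #|` F (n i)|%:R)) ->
  (packing_sum t I n <= c%:E * packing_sum s I n)%E.
Proof.
move=> c0 le; apply: ge_ereal_sup => _ [A [finA AI] <-].
apply: (@le_trans _ _
    (c%:E * \sum_(i \in A) (expR (- s * #|` F (n i)|%:R))%:E)%E).
  rewrite ge0_mule_fsumr; last by move=> i; rewrite lee_fin expR_ge0.
  rewrite lee_fsum// => i /AI Ii; rewrite -EFinM lee_fin; exact: le.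
by apply: lee_wpmul2l => //; apply: ereal_sup_ubound; exists A.
Qed.

Lemma packing_N_ge0 Z N e s : (0 <= packing_N Z N e s)%E.
Proof.
apply: ereal_sup_ubound; exists set0, (fun=> point), (fun=> 0%N); split.
  by split => // i j [].
by rewrite /packing_sum esum_set0.
Qed.

Lemma packing_N_le Z N e s t (c : R) : 0 <= c ->
    (forall n, (N <= n)%N -> expR (- t * #|` F n|%:R) <=
                             c * expR (- s * #|` F n|%:R)) ->
  (packing_N Z N e t <= c%:E * packing_N Z N e s)%E.
Proof.
move=> c0 le; apply: ge_ereal_sup => _ [I [x [n [[Zx nN dI] ->]]]].
apply: le_trans (packing_sum_le (s := s) c0 _) _ => [i /nN|]; first exact: le.
apply: lee_wpmul2l => //; apply: ereal_sup_ubound.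
by exists I, x, n.
Qed.

Lemma packing_N_nonincreasing Z e s :
  {homo (fun N => packing_N Z N e s) : m n / (m <= n)%N >-> (n <= m)%E}.
Proof.
move=> m n mn; apply: ereal_sup_le => _ [I [x [k [[Zx nk dk] ->]]]].
exists I, x, k; split => //; split => // i Ii.
exact: leq_trans mn (nk _ Ii).
Qed.

Lemma packing_preE Z e s :
  packing_pre Z e s = ereal_inf (range (fun N => packing_N Z N e s)).
Proof.
by apply/cvg_lim => //; apply: ereal_nonincreasing_cvgn;
  exact: packing_N_nonincreasing.
Qed.

Lemma packing_pre_le Z N e s : (packing_pre Z e s <= packing_N Z N e s)%E.
Proof. by rewrite packing_preE; apply: ereal_inf_lbound; exists N. Qed.

Lemma packing_pre_ge0 Z e s : (0 <= packing_pre Z e s)%E.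
Proof.
by rewrite packing_preE; apply: le_ereal_inf_tmp => _ [N _ <-];
  exact: packing_N_ge0.
Qed.

Lemma packing_measure_ge0 Z e s : (0 <= packing_measure Z e s)%E.
Proof.
apply: le_ereal_inf_tmp => _ [Zs _ <-].
by apply: nneseries_ge0 => *; exact: packing_pre_ge0.
Qed.

Lemma packing_measure_nonincreasing Z e s t :
  s <= t -> (packing_measure Z e t <= packing_measure Z e s)%E.
Proof.
move=> st; apply: le_ereal_inf_tmp => _ [Zs ZZs <-].
apply: (@le_trans _ _ (\sum_(i <oo) packing_pre (Zs i) e t)%E).
  by apply: ereal_inf_lbound; exists Zs.
apply: lee_nneseries => i *; first exact: packing_pre_ge0.
rewrite [leRHS]packing_preE; apply: le_ereal_inf_tmp => _ [N _ <-].
apply: le_trans (packing_pre_le _ N _ _) _; rewrite -[leRHS]mul1e.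
apply: packing_N_le => // n _.
by rewrite mul1r ler_expR ler_wpM2r// lerN2.
Qed.

Lemma packing_pre_eq0 Z e s t : growth_condition F -> s < t ->
  (packing_pre Z e s < +oo)%E -> packing_pre Z e t = 0%E.
Proof.
move=> gF st; rewrite packing_preE => /ereal_inf_lt[_ [N0 _ <-]] N0oo.
apply/eqP; rewrite eq_le packing_pre_ge0 andbT.
have C0 := packing_N_ge0 Z N0 e s.
have Cfin : packing_N Z N0 e s \is a fin_num by rewrite ge0_fin_numE.
pose C := fine (packing_N Z N0 e s).
have {}C0 : 0 <= C by exact: fine_ge0.
apply/lee_addgt0Pr => d d0; rewrite add0e.
pose c : R := d / (C + 1).
have c0 : 0 < c by rewrite divr_gt0// ltr_wpDl.
pose M : R := `|- ln c / (t - s)|.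
have [N1 _ N1F] : \forall n \near \oo, M <= #|` F n|%:R.
  near=> n.
  have lnn : 1 <= ln (n%:R : R).
    rewrite -[leLHS]expRK ler_ln ?posrE ?expR_gt0//.
      by near: n; exact: nbhs_infty_ger.
    by rewrite ltr0n; near: n; exact: nbhs_infty_gt.
  have : M <= #|` F n|%:R / ln n%:R by near: n; exact: (cvgry_ge gF).
  rewrite ler_pdivlMr ?(lt_le_trans ltr01)//; apply: le_trans.
  by rewrite ler_peMr// normr_ge0.
apply: le_trans (packing_pre_le _ (maxn N0 N1) _ _) _.
apply: (@le_trans _ _ (c%:E * packing_N Z (maxn N0 N1) e s)%E).
  apply: packing_N_le; first exact: ltW.
  move=> n; rewrite geq_max => /andP[_ /N1F /= Mn].
  rewrite -{1}(lnK (x := c)) ?posrE// -expRD ler_expR.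
  rewrite -lerBlDr -mulrBl opprK addrC -(opprB t s) mulNr lerNl.
  rewrite mulrC -ler_pdivrMr ?subr_gt0//; apply: le_trans Mn.
  exact: ler_norm.
apply: (@le_trans _ _ (c%:E * C%:E)%E).
  rewrite fineK//; apply: lee_wpmul2l; first exact: ltW.
  by apply: packing_N_nonincreasing; exact: leq_maxl.
rewrite -EFinM lee_fin /c mulrAC ler_pdivrMr ?ltr_wpDl//.
by rewrite ler_pM2l// lerDl.
Unshelve. all: by end_near. Qed.

Lemma packing_measure_gt Z e s :
  (packing_entropy_at Z e < s%:E)%E -> packing_measure Z e s = 0%E.
Proof.
move=> /ereal_inf_lt[_ [t [_ t0] <-]]; rewrite lte_fin => ts.
apply/eqP; rewrite eq_le packing_measure_ge0 andbT -t0.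
exact/packing_measure_nonincreasing/ltW.
Qed.

Lemma packing_measure_lt Z e s : growth_condition F -> 0 <= s ->
  (s%:E < packing_entropy_at Z e)%E -> packing_measure Z e s = +oo%E.
Proof.
move=> gF s0 sh; apply/eqP; rewrite -leye_eq leNgt; apply/negP => soo.
have mt0 t : s < t -> packing_measure Z e t = 0%E.
  move=> st; apply/eqP; rewrite eq_le packing_measure_ge0 andbT.
  have /ereal_inf_lt[_ [Zs ZZs <-] Zsoo] := soo.
  apply: (@le_trans _ _ (\sum_(i <oo) packing_pre (Zs i) e t)%E).
    by apply: ereal_inf_lbound; exists Zs.
  rewrite eseries0// => i _ _; apply: (packing_pre_eq0 gF st).
  apply: le_lt_trans Zsoo.
  have ge0 n : (0 <= packing_pre (Zs n) e s)%E by exact: packing_pre_ge0.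
  apply: le_trans (nneseries_lim_ge i.+1 _) => //.
  by rewrite big_nat_recr//= leeDr// sume_ge0.
suff : (packing_entropy_at Z e <= s%:E)%E by rewrite leNgt sh.
apply/lee_addgt0Pr => d d0; apply: ereal_inf_lbound.
exists (s + d) => //; split; first by rewrite addr_ge0// ltW.
by rewrite mt0// ltrDl.
Qed.

End Entropy.

Arguments borelType {R} X.
Arguments growth_condition R {G} F.

(* Main.v *)
(* Lower bound on packing entropy: fix mu with mu Z = 1 and r < s, and let E be
   a piece of a cover of Z whose packing premeasure at exponent r is finite.
   The points x of E with mu (B_{F_n}(x, e)) <= exp (- s |F_n|) are covered by
   the e-balls around a maximal packing with e/3-balls, so they have measure
   at most C exp (- (s - r) |F_n|); by the growth condition this is summable,
   and by Borel-Cantelli the local entropy exceeds s only on a null set.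

   Upper bound: let 0 <= s < s' be below the packing entropy of Z at scale
   eps.  As F is neither nested nor Folner, the Bowen balls attached to
   different branches of a Cantor construction cannot be kept disjoint.  A
   tree is built instead in which only the children w of a common node have
   disjoint closed Bowen balls, with conditional weights at most
   exp (- s' |F_w|).  For any probability measure, and in particular for the
   one carried by the tree, Markov's inequality bounds the conditional weight
   of the children whose Bowen ball has mass above exp (- s |F_w|) by
   exp (- (s' - s) |F_w|), which tends to 0 along the levels.  Hence almost
   every point lies in good balls at infinitely many levels, where the rate is
   at least s.  A Souslin scheme for Z keeps the limit points inside Z, and the
   measure is the image of the uniform law on [0, 1] under the branch map. *)

Require Import Defs.
From HB Require Import structures.
From mathcomp Require Import all_boot all_order all_algebra finmap.
From mathcomp Require Import all_classical all_reals all_analysis measurable_realfun.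
From mathcomp Require Import zify ring lra.

Set Implicit Arguments.
Unset Strict Implicit.
Unset Printing Implicit Defensive.

Import Order.TTheory GRing.Theory Num.Theory.
Import numFieldNormedType.Exports.

Local Open Scope classical_set_scope.
Local Open Scope ring_scope.

(** * Bowen metrics *)

(** Both entropies are monotone in the radius, so their limits at 0 become suprema, and a lower
    bound at one radius is enough. *)
Lemma lim_at_right0_ereal_sup (R : realType) (f : R -> \bar R) :
    (forall a b, 0 < a -> a <= b -> (f b <= f a)%E) ->
  lim (f e @[e --> 0^'+]) = ereal_sup (f @` [set e | 0 < e]).
Proof.
move=> fmono; have -> : [set e : R | 0 < e] = [set` `]0, +oo[].
  by apply/seteqP; split => e /=; rewrite in_itv/= andbT.
apply/cvg_lim => //; apply: nonincreasing_at_right_cvge => //.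
move=> a b; rewrite !in_itv/= !andbT => a0 b0 ab; exact: fmono.
Qed.

Section bowen_metric.
Context {R : realType} {X : pmetricType R} {G : groupType}.
Variable act : G -> X -> X.
Implicit Types (A : {fset G}) (x y z : X) (e : R).

Lemma bowen_dist_ge0 A x y : 0 <= bowen_dist act A x y.
Proof. exact: bigmax_ge_id. Qed.

Lemma bowen_dist_leP A x y e : 0 <= e ->
  bowen_dist act A x y <= e <->
  forall g, g \in A -> mdist (act g x) (act g y) <= e.
Proof.
move=> e0; split => [le g gA|h].
  apply: le_trans le; rewrite /bowen_dist.
  exact: (@le_bigmax_seq _ _ _ _ 0 _ xpredT
    (fun g => mdist (act g x) (act g y)) gA isT).
by rewrite /bowen_dist big_seq; exact: bigmax_le.
Qed.

Lemma bowen_dist_ltP A x y e : 0 < e ->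
  bowen_dist act A x y < e <->
  forall g, g \in A -> mdist (act g x) (act g y) < e.
Proof.
move=> e0; split => [lt g gA|h].
  apply: le_lt_trans lt; rewrite /bowen_dist.
  exact: (@le_bigmax_seq _ _ _ _ 0 _ xpredT
    (fun g => mdist (act g x) (act g y)) gA isT).
by rewrite /bowen_dist big_seq; exact: bigmax_lt.
Qed.

Lemma bowen_dist_sym A x y : bowen_dist act A x y = bowen_dist act A y x.
Proof. by apply: eq_bigr => g _; rewrite metric_sym. Qed.

Lemma bowen_dist_triangle A x y z :
  bowen_dist act A x z <= bowen_dist act A x y + bowen_dist act A y z.
Proof.
apply/bowen_dist_leP; first by rewrite addr_ge0// bowen_dist_ge0.
move=> g gA; apply: le_trans (metric_triangle _ (act g y) _) _.
by apply: lerD; move: g gA; apply/bowen_dist_leP => //; exact: bowen_dist_ge0.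
Qed.

Hypothesis act_cont : forall g, continuous (act g).

Lemma bowen_dist_near A x e : 0 < e ->
  \forall y \near x, bowen_dist act A x y < e.
Proof.
move=> e0; suff : \forall y \near x,
    forall g, g \in enum_fset A -> mdist (act g x) (act g y) < e.
  by apply: filterS => y h; exact/bowen_dist_ltP.
elim: (enum_fset A) => [|g s IH]; first by near=> y => ?; rewrite in_nil.
have /metricType_numDomainType.cvgr_dist_lt /(_ _ e0) ag := @act_cont g x.
near=> y => h; rewrite inE => /predU1P[->|]; first by near: y.
by move: h; near: y.
Unshelve. all: by end_near. Qed.

Lemma open_bowen_ball A x e : open (bowen_ball act A x e).
Proof.
rewrite openE => y /= xye; rewrite /bowen_ball/= in xye.
have : 0 < e - bowen_dist act A x y by rewrite subr_gt0.
move=> /(bowen_dist_near A y); apply: filterS => z yz.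
rewrite /bowen_ball/=; apply: le_lt_trans (bowen_dist_triangle _ _ y _) _.
by rewrite -ltrBrDl.
Qed.

Lemma closed_bowen_cball A x e : closed (bowen_cball act A x e).
Proof.
rewrite -[X in closed X]setCK; apply: open_closedC; rewrite openE => y /=.
move/negP; rewrite -ltNge -subr_gt0 => /(bowen_dist_near A y).
apply: filterS => z yz; apply/negP; rewrite -ltNge.
have := bowen_dist_triangle A x z y; rewrite (bowen_dist_sym _ z y).
by move: yz; lra.
Qed.

End bowen_metric.

(** * Souslin schemes of Borel sets *)

Fixpoint rprefix (nu : nat -> nat) (k : nat) : seq nat :=
  if k is k'.+1 then nu k' :: rprefix nu k' else [::].

Lemma rprefix_cons nu k :
  rprefix nu k.+1 = rcons (rprefix (nu \o succn) k) (nu 0%N).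
Proof. by elim: k => // k IH; rewrite [LHS]/= -/(rprefix nu k.+1) IH. Qed.

Lemma nth_rev_rprefix nu k j : (j < k)%N -> nth 0%N (rev (rprefix nu k)) j = nu j.
Proof.
elim: k => // k IH; rewrite ltnS leq_eqVlt /= rev_cons nth_rcons size_rev.
have -> : size (rprefix nu k) = k by elim: k {IH} => //= k ->.
by case/predU1P => [->|jk]; rewrite ?ltnn ?eqxx ?jk ?IH.
Qed.

Lemma size_rprefix nu k : size (rprefix nu k) = k.
Proof. by elim: k => //= k ->. Qed.

(** Serves countable intersections, where a component scheme advances only at some steps. Lengths
    are unbounded and grow by at most one, so every length occurs. *)
Lemma slow_chain_rprefix (t : nat -> seq nat) :
    t 0%N = [::] ->
    (forall k, t k.+1 = t k \/ exists n, t k.+1 = n :: t k) ->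
    (forall j, exists k, (j < size (t k))%N) ->
  exists nu, forall j, exists k, t k = rprefix nu j.
Proof.
move=> t0 tS /choice[K tK].
have cons k l j : (k <= l)%N -> (j < size (t k))%N ->
    (j < size (t l))%N /\ nth 0%N (rev (t l)) j = nth 0%N (rev (t k)) j.
  move=> kl jk; elim: l kl => [|l IH]; first by rewrite leqn0 => /eqP <-.
  rewrite leq_eqVlt => /predU1P[<-//|/IH[jl <-]].
  case: (tS l) => [->//|[n ->]]; split; first exact: (leq_trans jl).
  by rewrite rev_cons nth_rcons size_rev jl.
(* A filled position never changes again, so any stage longer than [j] gives the same value. *)
pose nu j := nth 0%N (rev (t (K j))) j.
have tE k : t k = rprefix nu (size (t k)).
  apply: (can_inj revK); apply: (@eq_from_nth _ 0%N).
    by rewrite !size_rev size_rprefix.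
  move=> j; rewrite size_rev => jk; rewrite nth_rev_rprefix// /nu.
  have [kK|Kk] := leqP k (K j); first by have [_ ->] := cons _ _ _ kK jk.
  by have [_ ->] := cons _ _ _ (ltnW Kk) (tK j).
exists nu => j; suff [k tk] : exists k, size (t k) = j.
  by exists k; rewrite tE tk.
have : (j <= size (t (K j)))%N := ltnW (tK j).
elim: (K j) => [|k IH]; first by rewrite t0 leqn0 => /eqP ->; exists 0%N; rewrite t0.
case: (tS k) => [->//|[n tkn]].
by rewrite leq_eqVlt => /predU1P[->|]; [exists k.+1|rewrite tkn ltnS].
Qed.

Section souslin_scheme.
Context {T : topologicalType}.
Implicit Types Z : set T.

(* Indices are reversed finite sequences, so that [n :: s] extends [s]. *)
Definition souslin_scheme Z (g : seq nat -> set T) : Prop :=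
  [/\ g [::] = Z,
      forall s, g s `<=` \bigcup_n g (n :: s),
      forall n s, g (n :: s) `<=` g s
    & forall nu, \bigcap_k closure (g (rprefix nu k)) `<=` Z].

Lemma closed_scheme Z : closed Z -> exists g, souslin_scheme Z g.
Proof.
move=> cZ; exists (fun=> Z); split=> // [_ x Zx|_ _ x //|nu x]; first by exists 0%N.
by move=> /(_ 0%N I); rewrite -(closure_id Z).1.
Qed.

(** The earliest index, which is the last entry of the reversed sequence, selects the member of the
    union; the rest indexes its own scheme. *)
Lemma bigcup_scheme (Zs : nat -> set T) :
    (forall i, exists g, souslin_scheme (Zs i) g) ->
  exists g, souslin_scheme (\bigcup_i Zs i) g.
Proof.
move=> /choice[gs sgs].
pose g s := if s is n :: s' then gs (last n s') (belast n s') else \bigcup_i Zs i.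
have gE t i : g (rcons t i) = gs i t.
  by case: t => //= n t; rewrite last_rcons belast_rcons.
exists g; split => //.
- move=> s; case: (lastP s) => [x [i _ Zx]|t i x].
    by exists i => //; rewrite (gE [::]) (let: And4 h _ _ _ := sgs i in h).
  rewrite gE; have [_ h _ _] := sgs i => /h[n _ gx].
  by exists n => //; rewrite -rcons_cons gE.
- move=> n s; case: (lastP s) => [|t i].
    by rewrite (gE [::]); have [-> _ _ _] := sgs n => x; exists n.
  by rewrite -rcons_cons !gE; have [_ _ h _] := sgs i; exact: h.
- move=> nu x gx; exists (nu 0%N) => //; have [_ _ _ h] := sgs (nu 0%N).
  by apply: (h (nu \o succn)) => k _; have := gx k.+1 I; rewrite rprefix_cons gE.
Qed.

(* [dispatch s i] collects the entries of [s] that are meant for the [i]-th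
   scheme: position [k] is assigned to [logn 2 k.+1], so that every scheme
   is served infinitely often. *)
Fixpoint dispatch (s : seq nat) (i : nat) : seq nat :=
  if s is n :: s' then
    if logn 2 (size s').+1 == i then n :: dispatch s' i else dispatch s' i
  else [::].

(** Each new index advances exactly one component scheme, and along an infinite branch every
    component advances infinitely often. *)
Lemma bigcap_scheme (Zs : nat -> set T) :
    (forall i, exists g, souslin_scheme (Zs i) g) ->
  exists g, souslin_scheme (\bigcap_i Zs i) g.
Proof.
move=> /choice[gs sgs]; exists (fun s => \bigcap_i gs i (dispatch s i)); split.
- by apply: eq_bigcapr => i _; have [] := sgs i.
- move=> s x gx; pose i := logn 2 (size s).+1.
  have [_ h _ _] := sgs i; have [n _ gnx] := h _ _ (gx i I).
  exists n => // j _ /=; case: eqP => [<-//|_]; exact: gx.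
- move=> n s x gx i _; have := gx i I => /=.
  by case: eqP => // _; have [_ _ h _] := sgs i; exact: h.
- move=> nu x gx i _; have [_ _ _ h] := sgs i.
  have [||j|nu' tnu'] := @slow_chain_rprefix (fun k => dispatch (rprefix nu k) i).
  + by [].
  + by move=> k /=; case: eqP => _; [right; exists (nu k)|left].
  + suff unb k : exists2 l, (k <= l)%N &
        (size (dispatch (rprefix nu k) i) < size (dispatch (rprefix nu l) i))%N.
      elim: j => [|j [k jk]]; first by have [l _ kl] := unb 0%N; exists l.
      by have [l _ kl] := unb k; exists l; exact: leq_ltn_trans jk kl.
    have mono m l : (size (dispatch (rprefix nu m) i) <=
                     size (dispatch (rprefix nu (l + m)) i))%N.
      elim: l => // l /leq_trans; apply; rewrite addSn /=.
      by case: eqP => //= _; exact: leqnSn.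
    (* [l.+1] is an odd multiple of [2 ^ i], so position [l] is assigned to scheme [i]; the odd
       factor makes [l] at least [k]. *)
    pose l := (2 ^ i * (2 * k).+1).-1.
    have l1 : l.+1 = (2 ^ i * (2 * k).+1)%N by rewrite prednK// muln_gt0 expn_gt0.
    have kl : (k <= l)%N.
      rewrite -ltnS l1; apply: (@leq_trans (2 * k).+1).
        by rewrite ltnS leq_pmull.
      by rewrite leq_pmull// expn_gt0.
    exists l.+1; first exact: leqW.
    rewrite /= size_rprefix l1 lognM ?expn_gt0// pfactorK// lognE /=.
    rewrite dvdn2 /= oddM/= addn0 eqxx /= ltnS.
    by have := mono k (l - k)%N; rewrite subnK.
  + apply: (h nu') => j _; have [k <-] := tnu' j.
    by apply: closureS (gx k I) => y; exact.
Qed.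

End souslin_scheme.

(** Sets that have a scheme together with their complement form a sigma-algebra. It contains the
    open sets, which are countable unions of closed ones. *)
Lemma borel_scheme (R : realType) (X : pmetricType R) (Z : set X) :
  borel Z -> exists g, souslin_scheme Z g.
Proof.
pose C (Z : set X) := (exists g, souslin_scheme Z g) /\ exists g, souslin_scheme (~` Z) g.
suff sC : <<s @open X >> `<=` C by move=> /sC[].
apply: smallest_sub.
  split.
  - by rewrite /C setC0; split; apply: closed_scheme; [exact: closed0|exact: closedT].
  - by move=> A [hA hAC]; rewrite setTD /C setCK.
  - move=> A hA; split; first by apply: bigcup_scheme => i; case: (hA i).
    by rewrite setC_bigcup; apply: bigcap_scheme => i; case: (hA i).
move=> O oO; split; last by apply: closed_scheme; exact: open_closedC.
(* A closed exhaustion of [O], by distance to its complement. *)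
pose D n := [set x : X | forall y, ~ O y -> n.+1%:R^-1 <= mdist x y :> R].
have -> : O = \bigcup_n D n.
  apply/seteqP; split=> [x Ox|x [n _ Dx]].
    have /metricType_numDomainType.nbhs_mdistP[e /= e0 xe] := open_nbhs_nbhs (conj oO Ox).
    have [n _ ne] : \forall n \near \oo, n.+1%:R^-1 < e.
      exact: near_infty_natSinv_lt (PosNum e0).
    exists n => // y Oy; rewrite leNgt; apply/negP => xy.
    by apply: Oy; apply: xe => /=; exact: lt_trans xy (ne _ (leqnn n)).
  by apply: contrapT => /Dx; rewrite mdistxx leNgt invr_gt0 ltr0n.
apply: bigcup_scheme => n; apply: closed_scheme.
rewrite -[X in closed X]setCK; apply: open_closedC; rewrite openE => x /=.
move=> /existsNP[y] /not_implyP[Oy] /negP; rewrite -ltNge -subr_gt0 => d0.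
apply/metricType_numDomainType.nbhs_mdistP; exists (n.+1%:R^-1 - mdist x y) => //.
move=> z /= xz Dz; have := Dz _ Oy; apply/negP; rewrite -ltNge.
apply: le_lt_trans (metric_triangle _ x _) _; rewrite metric_sym.
by move: xz; rewrite /= ltrBrDr.
Qed.

(** * Upper limits and the growth condition *)

Section limn_esup_facts.
Context {R : realType}.
Implicit Types (u : nat -> \bar R) (l : \bar R).
Local Open Scope ereal_scope.

Lemma lt_limn_esup u l : l < limn_esup u ->
  forall N, exists2 n, (N <= n)%N & l < u n.
Proof.
move=> lu N; suff /ereal_sup_gt[_ [n Nn <-] ln] :
  l < ereal_sup (u @` [set n | (N <= n)%N]) by exists n.
apply: lt_le_trans lu _; apply: ereal_inf_lbound.
by exists [set n | (N <= n)%N] => //; exact: nbhs_infty_ge.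
Qed.

Lemma le_limn_esup u l : (forall N, exists2 n, (N <= n)%N & l <= u n) ->
  l <= limn_esup u.
Proof.
move=> lu; apply: le_ereal_inf_tmp => _ [V [N _ NV] <-].
have [n Nn /le_trans] := lu N; apply; apply: ereal_sup_ubound.
by exists n => //; exact: NV.
Qed.

(** The bound equals [c / (n + 1) - c / (n + 2)], so its partial sums telescope. *)
Lemma nneseries_lt_pinfty_telescope u (c : R) : (forall n, 0 <= u n) ->
    (forall n, u n <= (c / (n.+1 * n.+2)%:R)%:E) ->
  \sum_(n <oo) u n < +oo.
Proof.
move=> u0 uc; apply: (@le_lt_trans _ _ `|c|%:E); last by rewrite ltry.
apply: lime_le; first exact: is_cvg_nneseries.
apply: nearW => n; apply: (@le_trans _ _ (`|c| * (1 - n.+1%:R^-1))%:E).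
  elim: n => [|n IH]; first by rewrite big_nil lee_fin invr1 subrr mulr0.
  rewrite big_nat_recr//=; apply: le_trans (leeD IH (uc n)) _.
  rewrite -EFinD lee_fin natrM.
  have -> : (`|c| * (1 - n.+2%:R^-1) =
      `|c| * (1 - n.+1%:R^-1) + `|c| / (n.+1%:R * n.+2%:R))%R.
    rewrite -(natr1 n.+1); field.
    by rewrite nat1r natr1 !pnatr_eq0.
  by rewrite lerD2l ler_wpM2r ?ler_norm// invr_ge0 mulr_ge0.
by rewrite lee_fin ler_piMr// gerBl invr_ge0.
Qed.

End limn_esup_facts.

Section growth.
Context {R : realType} {G : groupType} (F : nat -> {fset G}).
Hypothesis growthF : growth_condition R F.

Lemma growth_ge_ln (M : R) :
  \forall n \near \oo, M * ln n%:R <= #|` F n|%:R.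
Proof.
near=> n; have lnn : 0 < ln (n%:R : R).
  by rewrite ln_gt0// ltr1n; near: n; exact: nbhs_infty_gt.
rewrite -ler_pdivlMr//; near: n; exact: (cvgry_ge growthF).
Unshelve. all: by end_near. Qed.

Lemma growth_card_ge (M : R) : \forall n \near \oo, M <= #|` F n|%:R.
Proof.
near=> n; apply: le_trans (ler_norm M) _.
have : `|M| * ln n%:R <= #|` F n|%:R :> R by near: n; exact: growth_ge_ln.
apply: le_trans; rewrite ler_peMr// -[leLHS]expRK ler_ln ?posrE ?expR_gt0//.
  by near: n; exact: nbhs_infty_ger.
by rewrite ltr0n; near: n; exact: nbhs_infty_gt.
Unshelve. all: by end_near. Qed.

Lemma growth_expR_le (d c : R) : 0 < d -> 0 < c ->
  \forall n \near \oo, expR (- d * #|` F n|%:R) <= c.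
Proof.
move=> d0 c0; near=> n; rewrite -[leRHS](lnK (x := c)) ?posrE// ler_expR.
rewrite mulNr lerNl mulrC -ler_pdivrMr//; near: n; exact: growth_card_ge.
Unshelve. all: by end_near. Qed.

Lemma growth_expR_le_telescope (d : R) : 0 < d ->
  \forall n \near \oo, expR (- d * #|` F n|%:R) <= (n.+1 * n.+2)%:R^-1.
Proof.
move=> d0; near=> n; have n1 : (1 < n)%N by near: n; exact: nbhs_infty_gt.
have n0 : 0 < n%:R :> R by rewrite ltr0n ltnW.
(* The constant 4 yields [exp (- d |F_n|) <= n ^ -4], and [(n + 1) (n + 2) <= n ^ 4] once
   [n >= 2]. *)
have Fn : 4 / d * ln n%:R <= #|` F n|%:R :> R by near: n; exact: growth_ge_ln.
apply: (@le_trans _ _ ((n%:R : R) ^- 4)).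
  rewrite -[X in X ^- 4]lnK ?posrE// -expRM_natl -expRN ler_expR mulNr lerN2.
  by move: Fn; rewrite mulrAC ler_pdivrMr// [leRHS]mulrC ?mulr_natl.
rewrite lef_pV2 ?posrE ?exprn_gt0 ?ltr0n ?muln_gt0 ?(ltnW n1)//.
rewrite -natrX ler_nat (expnM n 2 2) -mulnn; apply: leq_mul; rewrite expnS expn1; nia.
Unshelve. all: by end_near. Qed.

End growth.

(** * The local entropy is bounded by the packing entropy *)

Section borel_measurable.
Context {R : realType} {X : pmetricType R}.

Lemma open_borel (U : set X) : open U -> measurable (U : set (borelType X)).
Proof. exact: sub_sigma_algebra. Qed.

Lemma closed_borel (C : set X) : closed C -> measurable (C : set (borelType X)).
Proof.
by move=> cC; rewrite -[C]setCK; apply: measurableC; apply: open_borel; exact: closed_openC.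
Qed.

End borel_measurable.

Section lower_bound.
Context {R : realType} {X : pmetricType R} {G : groupType}.
Variables (act : G -> X -> X) (F : nat -> {fset G}).
Hypothesis act_cont : forall g, continuous (act g).
Hypothesis growthF : growth_condition R F.
Variable mu : probability (borelType X) R.
Implicit Types (E : set X) (e s r : R).

(* A packing of [E] of maximal cardinality with balls of radius [e / 3]
   becomes a cover of [E] when the radii are tripled. *)
Lemma packing_cover E N n e s r (C : R) : 0 < e -> (N <= n)%N ->
    (packing_N act F E N (e / 3) r <= C%:E)%E ->
    (forall x, E x -> (mu (bowen_ball act (F n) x e) <=
                       (expR (- s * #|` F n|%:R))%:E)%E) ->
  exists U : set (borelType X), [/\ measurable U, E `<=` U &
    (mu U <= (C * expR (- (s - r) * #|` F n|%:R))%:E)%E].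
Proof.
move=> e0 Nn NC Es.
pose P m := exists x : nat -> X, (forall i, (i < m)%N -> E (x i)) /\
  trivIset `I_m (fun i => bowen_cball act (F n) (x i) (e / 3)).
pose w := expR (- r * #|` F n|%:R).
(* All balls share the time [n], so a packing by [m] of them weighs [m * w], and the packing bound
   limits [m]. *)
have PC m : P m -> m%:R * w <= C.
  move=> [x [Ex tx]]; rewrite -lee_fin; apply: le_trans NC.
  apply: (@le_trans _ _ (packing_sum F r `I_m (fun=> n))); last first.
    by apply: ereal_sup_ubound; exists `I_m, x, (fun=> n).
  rewrite /packing_sum esum_fset//.
  by rewrite -fsbig_ord sumEFin sumr_const card_ord mulr_natl.
have [m [[x [Ex tx]] maxm]] : exists m, P m /\ forall k, P k -> (k <= m)%N.
  have P0 : exists m, `[< P m >].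
    by exists 0%N; apply/asboolP; exists (fun=> point); split => // i j [].
  have Pub m : `[< P m >] -> (m <= Num.trunc (C / w))%N.
    move=> /asboolP/PC mC; rewrite -ltnS -(ltr_nat R).
    by apply: le_lt_trans (truncnS_gt _); rewrite ler_pdivlMr// expR_gt0.
  case: (ex_maxnP P0 Pub) => m /asboolP Pm maxm; exists m; split => // k Pk.
  by apply: maxm; exact/asboolP.
pose U := \bigcup_(i < m) bowen_ball act (F n) (x i) e.
have mball i : measurable (bowen_ball act (F n) (x i) e : set (borelType X)).
  apply: open_borel; exact: open_bowen_ball.
exists U; split.
- by apply: bigcup_measurable => i _; exact: mball.
(* A point [y] outside [U] would be a further centre: if its [e / 3]-ball met that of [x i], then
   [y] would be within [2 e / 3] of [x i]. *)
- move=> y Ey; apply: contrapT => Uy; suff : P m.+1 by move/maxm; rewrite ltnn.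
  have far i : (i < m)%N -> bowen_cball act (F n) (x i) (e / 3) `&`
      bowen_cball act (F n) y (e / 3) = set0.
    move=> im; apply/seteqP; split => // z [/= xz yz]; apply: Uy; exists i => //.
    rewrite /bowen_ball/=; apply: le_lt_trans (bowen_dist_triangle _ _ _ z _) _.
    move: xz yz; rewrite /bowen_cball/= (bowen_dist_sym _ _ z); lra.
  exists (fun i => if (i < m)%N then x i else y); split.
    by move=> i; rewrite ltnS; case: ifP => // im _; exact: Ex.
  move=> i j /= im jm; case: ifPn => [im'|im']; case: ifPn => [jm'|jm'].
  + exact: tx.
  + by rewrite far// => /set0P; rewrite eqxx.
  + by rewrite setIC far// => /set0P; rewrite eqxx.
  + by move=> _; lia.
- apply: (@le_trans _ _ (\sum_(i < m) mu (bowen_ball act (F n) (x i) e))%E).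
    rewrite (fsbig_ord _ _ (fun i => mu (bowen_ball act (F n) (x i) e))).
    apply: content_sub_fsum => //.
    by apply: bigcup_measurable => i _; exact: mball.
  apply: (@le_trans _ _ (\sum_(i < m) (expR (- s * #|` F n|%:R))%:E)%E).
    by apply: lee_sum => i _; exact/Es/Ex.
  rewrite sumEFin sumr_const card_ord lee_fin.
  have -> : expR (- s * #|` F n|%:R) = w * expR (- (s - r) * #|` F n|%:R).
    by rewrite -expRD; congr expR; ring.
  by rewrite -[leLHS]mulr_natl mulrA ler_wpM2r ?expR_ge0// PC//; exists x.
Qed.

Lemma packing_pre_negligible E e s r : 0 < e -> r < s ->
    (packing_pre act F E (e / 3) r < +oo)%E ->
    (forall x, E x -> forall N, exists2 n, (N <= n)%N &
       (mu (bowen_ball act (F n) x e) <= (expR (- s * #|` F n|%:R))%:E)%E) ->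
  mu.-negligible (E : set (borelType X)).
Proof.
move=> e0 rs; rewrite packing_preE => /ereal_inf_lt[_ [N0 _ <-] N0oo] Es.
have [C NC] : exists C : R, packing_N act F E N0 (e / 3) r = C%:E.
  exists (fine (packing_N act F E N0 (e / 3) r)); rewrite fineK//.
  by rewrite ge0_fin_numE// packing_N_ge0.
have C0 : 0 <= C by rewrite -lee_fin -NC packing_N_ge0.
have sr0 : 0 < s - r by rewrite subr_gt0.
have [N1 _ N1F] := growth_expR_le_telescope growthF sr0.
pose En n := [set x | E x /\
  (mu (bowen_ball act (F n) x e) <= (expR (- s * #|` F n|%:R))%:E)%E].
have N0C n : (packing_N act F (En n) N0 (e / 3) r <= C%:E)%E.
  rewrite -NC; apply: ereal_sup_le => _ [I [x [k [[Ex Nk tx] ->]]]].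
  by exists I, x, k; split => //; split => // i /Ex[].
have cover n : exists U : set (borelType X), (N0 <= n)%N -> [/\ measurable U,
    En n `<=` U & (mu U <= (C * expR (- (s - r) * #|` F n|%:R))%:E)%E].
  have [Nn|nN] := leqP N0 n; last by exists set0.
  by have [U hU] := packing_cover e0 Nn (N0C n) (fun x => @proj2 _ _); exists U.
have [U hU] := choice cover.
(* After the shift, the covers, valid from [N0] on, and the summable bound, valid from [N1] on, hold
   at every index. *)
pose V n := U (n + maxn N0 N1)%N.
have Nle n : (N0 <= n + maxn N0 N1)%N by rewrite (leq_trans (leq_maxl N0 N1))// leq_addl.
have mV n : measurable (V n) by have [] := hU _ (Nle n).
exists (lim_sup_set V); split.
- by apply: bigcap_measurable => // k _; apply: bigcup_measurable => j _.
- apply: lim_sup_set_cvg0 => //; apply: (@nneseries_lt_pinfty_telescope _ _ C) => // n.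
  have [_ _ /le_trans] := hU _ (Nle n); apply.
  rewrite lee_fin ler_wpM2l//.
  have /N1F/= /le_trans : (N1 <= n + maxn N0 N1)%N.
    by rewrite (leq_trans (leq_maxr N0 N1))// leq_addl.
  apply; rewrite lef_pV2 ?posrE ?ltr0n ?muln_gt0//.
  by rewrite ler_nat leq_mul// !ltnS leq_addr.
- move=> x Ex n _; have [k nk Bk] := Es x Ex (n + maxn N0 N1)%N.
  have kE : k = (k - maxn N0 N1 + maxn N0 N1)%N by rewrite subnK//; lia.
  exists (k - maxn N0 N1)%N; first by rewrite /=; lia.
  by rewrite /V -kE; have [|_ + _] := hU k; [lia|apply].
Qed.

End lower_bound.

(** Exchanges lower bounds on rates for upper bounds on masses; a null ball fits, its rate being
    [+oo]. *)
Lemma le_entropy_rate (R : realType) (c s : R) (m : \bar R) : 0 < c -> (0 <= m)%E ->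
  (s%:E <= - (c^-1%:E * lne m))%E = (m <= (expR (- s * c))%:E)%E.
Proof.
move=> c0 m0; rewrite leeNr lee_pdivrMl// -lee_lne ?in_itv/= ?m0 ?leey//; last first.
  by rewrite lee_fin expR_ge0.
by rewrite [(expR _ <= 0)%R]leNgt expR_gt0 /= expRK -EFinM mulrC.
Qed.

(** * Entropies as suprema over radii *)

Section entropy_sup.
Context {R : realType} {X : pmetricType R} {G : groupType}.
Variables (act : G -> X -> X) (F : nat -> {fset G}).
Hypothesis act_cont : forall g, continuous (act g).
Implicit Types (mu : probability (borelType X) R) (Z : set X) (e : R).

Lemma packing_measure_nonincreasing_radius Z a b s : a <= b ->
  (packing_measure act F Z b s <= packing_measure act F Z a s)%E.
Proof.
move=> ab; apply: le_ereal_inf_tmp => _ [Zs ZZs <-].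
apply: (@le_trans _ _ (\sum_(i <oo) packing_pre act F (Zs i) b s)%E).
  by apply: ereal_inf_lbound; exists Zs.
apply: lee_nneseries => i *; first exact: packing_pre_ge0.
rewrite [leRHS]packing_preE; apply: le_ereal_inf_tmp => _ [N _ <-].
apply: le_trans (packing_pre_le _ _ _ N _ _) _.
apply: ereal_sup_le => _ [I [x [n [[Zx Nn tx] ->]]]].
exists I, x, n; split => //; split => // j k Ij Ik [y [/= yj yk]].
by apply: tx => //; exists y; split; rewrite /bowen_cball/=; apply: le_trans ab.
Qed.

Lemma packing_entropyE Z :
  packing_entropy act F Z = ereal_sup (packing_entropy_at act F Z @` [set e | 0 < e]).
Proof.
apply: lim_at_right0_ereal_sup => a b _ ab; apply: ereal_inf_le_tmp.
move=> _ [s [s0 m0] <-]; exists s => //; split => //.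
apply/eqP; rewrite eq_le packing_measure_ge0 andbT -m0.
exact: packing_measure_nonincreasing_radius.
Qed.

Lemma packing_entropy_at_ge0 Z e : (0 <= packing_entropy_at act F Z e)%E.
Proof. by apply: le_ereal_inf_tmp => _ [s [s0 _] <-]; rewrite lee_fin. Qed.

Lemma packing_entropy_ge0 Z : (0 <= packing_entropy act F Z)%E.
Proof.
rewrite packing_entropyE; apply: le_trans (packing_entropy_at_ge0 Z 1) _.
by apply: ereal_sup_ubound; exists 1 => //=.
Qed.

Definition upper_local_rate mu x e : \bar R :=
  limn_esup (fun n => - ((#|` F n|%:R^-1)%:E * lne (mu (bowen_ball act (F n) x e))))%E.

Lemma upper_local_rate_nonincreasing mu x a b : a <= b ->
  (upper_local_rate mu x b <= upper_local_rate mu x a)%E.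
Proof.
move=> ab; rewrite /upper_local_rate /limn_esup !limf_esupE.
apply: le_ereal_inf_tmp => _ [V noV <-].
apply: le_trans (ereal_inf_lbound _) _; first by exists V.
apply: ge_ereal_sup => _ [n Vn <-].
apply: (@le_trans _ _ (- ((#|` F n|%:R^-1)%:E *
    lne (mu (bowen_ball act (F n) x a))))%E); last first.
  by apply: ereal_sup_ubound; exists n.
rewrite leeN2; apply: lee_wpmul2l; first by rewrite lee_fin invr_ge0.
rewrite lee_lne ?in_itv/= ?measure_ge0 ?leey//; apply: le_measure; rewrite ?inE.
- by apply: open_borel; exact: open_bowen_ball.
- by apply: open_borel; exact: open_bowen_ball.
- by move=> y; rewrite /bowen_ball/= => /lt_le_trans; apply.
Qed.

Lemma upper_local_entropy_atE mu x : upper_local_entropy_at act F mu x =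
  ereal_sup (upper_local_rate mu x @` [set e | 0 < e]).
Proof.
apply: lim_at_right0_ereal_sup => a b _; exact: upper_local_rate_nonincreasing.
Qed.

Lemma upper_local_rate_ge0 mu x e : (0 <= upper_local_rate mu x e)%E.
Proof.
apply: le_limn_esup => N; exists N => //.
rewrite leeNr oppe0 mule_ge0_le0//.
  by rewrite lne_le0; apply: probability_le1; apply: open_borel; exact: open_bowen_ball.
Qed.

Lemma upper_local_entropy_at_ge0 mu x : (0 <= upper_local_entropy_at act F mu x)%E.
Proof.
rewrite upper_local_entropy_atE; apply: le_trans (upper_local_rate_ge0 mu x 1) _.
by apply: ereal_sup_ubound; exists 1 => //=.
Qed.

End entropy_sup.

(* The integrand is not assumed to be measurable, so that its integral is a
   lower one: a supremum over the simple functions below it. *)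
Section lower_integral.
Context d (T : measurableType d) (R : realType) (mu : probability T R).
Variables (D : set T) (f : T -> \bar R).
Hypothesis f0 : forall x, (0 <= f x)%E.
Local Open Scope ereal_scope.
Import HBNNSimple.

(** A nonnegative simple function below the restriction of [f] to [D] is at most [s] outside a null
    set. *)
Lemma integral_le_of_negligible (s : R) : (0 <= s)%R ->
  mu.-negligible [set x | D x /\ s%:E < f x] -> \int[mu]_(x in D) f x <= s%:E.
Proof.
move=> s0 [N [mN muN DN]]; rewrite ge0_integralE//.
apply: ge_ereal_sup => _ [h hf <-]; rewrite -integralT_nnsfun.
apply: (@le_trans _ _ (\int[mu]_x (cst s%:E) x)); last first.
  rewrite integral_cst// -[leRHS]mule1; apply: lee_wpmul2l => //.
  exact: probability_le1.
apply: ae_ge0_le_integral => //.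
- by move=> x _; rewrite lee_fin.
- exact/measurable_EFinP.
exists N; split => // x /=; rewrite not_implyE => -[_ /negP].
rewrite -ltNge => sh; apply: DN; move: (lt_le_trans sh (hf x)).
by rewrite /patch; case: ifPn => [/set_mem//|_]; rewrite lte_fin ltNge s0.
Qed.

Lemma integral_ge_of_full (s : R) (E : set T) : (0 <= s)%R -> measurable E ->
  mu E = 1 -> (forall x, E x -> D x) -> (forall x, E x -> s%:E <= f x) ->
  s%:E <= \int[mu]_(x in D) f x.
Proof.
move=> s0 mE muE ED Es; rewrite ge0_integralE//.
pose h := scale_nnsfun (indic_nnsfun R mE) s0.
have <- : sintegral mu h = s%:E.
  rewrite -integralT_nnsfun.
  transitivity (\int[mu]_x (s%:E * (\1_E x)%:E)); first exact: eq_integral.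
  rewrite -[RHS]mule1 -muE ge0_integralZl//; first by rewrite integral_indic// setIT.
  - exact/measurable_EFinP/measurable_indic.
apply: ereal_sup_ubound; exists h => // x.
rewrite (_ : h x = (s * \1_E x)%R)// /patch indicE; case: (boolP (x \in E)) => [/set_mem Ex|_].
  by rewrite mulr1 mem_set ?Es//; exact: ED.
by rewrite mulr0; case: ifP.
Qed.

End lower_integral.

Section lower_bound.
Context {R : realType} {X : pmetricType R} {G : groupType}.
Variables (act : G -> X -> X) (F : nat -> {fset G}).
Hypothesis act_cont : forall g, continuous (act g).
Hypothesis growthF : growth_condition R F.
Variable mu : probability (borelType X) R.

(** Vanishing packing measure yields a countable cover of [Z] by pieces of finite premeasure, each
    contributing a null set. The radius [e / 3] is the one that [packing_cover] triples. *)
Lemma large_rate_negligible (Z : set X) (e r s : R) : 0 < e -> 0 <= r -> r < s ->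
    packing_measure act F Z (e / 3) r = 0%E ->
  mu.-negligible ([set x | Z x /\ (s%:E < upper_local_rate act F mu x e)%E]
    : set (borelType X)).
Proof.
move=> e0 r0 rs mr0.
have /ereal_inf_lt[_ [Zs ZZs <-] Zsoo] : (packing_measure act F Z (e / 3) r < +oo)%E.
  by rewrite mr0.
have Zsfin i : (packing_pre act F (Zs i) (e / 3) r < +oo)%E.
  have ge0 n : (0 <= packing_pre act F (Zs n) (e / 3) r)%E by exact: packing_pre_ge0.
  apply: le_lt_trans Zsoo; apply: le_trans (nneseries_lim_ge i.+1 _) => //.
  by rewrite big_nat_recr//= leeDr// sume_ge0.
pose E i := [set x | Zs i x /\ (s%:E < upper_local_rate act F mu x e)%E].
apply: (@negligibleS _ _ _ _ (\bigcup_i E i : set (borelType X))).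
  by move=> x [/ZZs[i _ Zx] sx]; exists i.
apply: negligible_bigcup => i.
apply: (@packing_pre_negligible _ _ _ act F act_cont growthF mu (E i) e s r) => //.
  apply: le_lt_trans (Zsfin i); rewrite !packing_preE.
  apply: le_ereal_inf_tmp => _ [N _ <-].
  apply: le_trans (ereal_inf_lbound _) _; first by exists N.
  apply: ereal_sup_le => _ [I [x [n [[Ex Nn tx] ->]]]].
  by exists I, x, n; split => //; split => // j /Ex[].
move=> x [_ /lt_limn_esup sx] N.
have [N1 _ N1F] := growth_card_ge growthF 1.
have [n Nn /ltW] := sx (maxn N N1); rewrite le_entropy_rate//.
  by exists n => //; lia.
by apply: (lt_le_trans ltr01); apply: N1F => /=; lia.
Qed.

Lemma upper_local_entropy_le (Z : set X) : borel Z ->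
  (upper_local_entropy act F mu Z <= packing_entropy act F Z)%E.
Proof.
move=> bZ; have := packing_entropy_ge0 act F Z.
case: (packing_entropy act F Z) (packing_entropyE act F Z) => [b bE b0|_ _|_];
  [|exact: leey|by rewrite leNgt ltNy0].
rewrite lee_fin in b0; apply/lee_addgt0Pr => d d0; rewrite -EFinD.
apply: integral_le_of_negligible => //.
- by move=> x; exact: upper_local_entropy_at_ge0.
- by rewrite addr_ge0// ltW.
(* Countably many radii suffice, since the rate grows as the radius shrinks. *)
pose e k : R := k.+1%:R^-1.
have e0 k : 0 < e k by rewrite invr_gt0.
apply: (@negligibleS _ _ _ _ (\bigcup_k
  [set x | Z x /\ ((b + d)%:E < upper_local_rate act F mu x (e k))%E] : set (borelType X))).
  move=> x [Zx]; rewrite upper_local_entropy_atE// => /ereal_sup_gt[_ [a /= a0 <-] bda].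
  have [k _ ka] : \forall n \near \oo, n.+1%:R^-1 < a.
    exact: near_infty_natSinv_lt (PosNum a0).
  exists k => //; split => //; apply: lt_le_trans bda _.
  by apply: upper_local_rate_nonincreasing => //; apply: ltW; exact: ka (leqnn k).
apply: negligible_bigcup => k.
(* The exponent [b + d / 2] is above the entropy, so the packing measure vanishes there, and still
   below the rate [b + d]. *)
apply: (@large_rate_negligible _ _ (b + d / 2)) => //; [lra|lra|].
apply: packing_measure_gt; apply: (@le_lt_trans _ _ b%:E); last by rewrite lte_fin; lra.
by rewrite bE; apply: ereal_sup_ubound; exists (e k / 3) => //=; rewrite divr_gt0.
Qed.

End lower_bound.

(** * Sets of sigma-finite packing premeasure *)

Section small_sets.
Context {R : realType} {X : pmetricType R} {G : groupType}.
Variables (act : G -> X -> X) (F : nat -> {fset G}) (e s : R).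
Hypothesis cptX : compact [set: X].
Implicit Types E D : set X.

(** The premeasures of the pieces are finite but need not be summable, so these sets form a
    sigma-ideal. *)
Definition small_set E := exists C : nat -> set X,
  E `<=` \bigcup_i C i /\ forall i, (packing_pre act F (C i) e s < +oo)%E.

Lemma small_sub E D : E `<=` D -> small_set D -> small_set E.
Proof. by move=> ED [C [DC Cfin]]; exists C; split => // x /ED/DC. Qed.

Lemma small_set0 : small_set set0.
Proof.
exists (fun=> set0); split => // _; apply: le_lt_trans (packing_pre_le _ _ _ 0 _ _) _.
apply: (@le_lt_trans _ _ 0%E) => //; apply: ge_ereal_sup => _ [I [x [n [[I0 _ _] ->]]]].
by rewrite /packing_sum esum1// => i /I0.
Qed.

Lemma small_bigcup (Es : nat -> set X) :
  (forall i, small_set (Es i)) -> small_set (\bigcup_i Es i).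
Proof.
move=> /choice[Cs Es_small]; have [C0 [_ C0fin]] := small_set0.
(* Pieces are reindexed by codes of pairs; a number that codes no pair receives a piece from the
   cover of [set0]. *)
exists (fun k => if @choice.unpickle (nat * nat)%type k is Some ij
  then Cs ij.1 ij.2 else C0 0%N); split.
  move=> x [i _ Ex]; have [/(_ x Ex)[j _ Cx] _] := Es_small i.
  by exists (choice.pickle (i, j)) => //; rewrite choice.pickleK.
by move=> k; case: choice.unpickle => [[i j]|//]; have [_] := Es_small i.
Qed.

(** A finite premeasure at [s] drops to zero at any larger exponent. Contrapositively, positive
    packing measure at [t] provides a set large enough to grow a tree in. *)
Lemma measure_eq0_small t E : s < t -> growth_condition R F ->
  small_set E -> packing_measure act F E e t = 0%E.
Proof.
move=> st growthF [C [EC Cfin]]; apply/eqP; rewrite eq_le packing_measure_ge0 andbT.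
apply: (@le_trans _ _ (\sum_(i <oo) packing_pre act F (C i) e t)%E).
  by apply: ereal_inf_lbound; exists C.
by rewrite eseries0// => i _ _; exact: (packing_pre_eq0 growthF st).
Qed.

(** Otherwise all packings from time [N] on weigh at most 1, and [E] alone is a cover of finite
    premeasure. A packing sum is a supremum of finite sums, so a finite subfamily reaches 1. *)
Lemma finite_packing E N : ~ small_set E -> exists m (x : nat -> X) (n : nat -> nat),
  [/\ forall i, (i < m)%N -> E (x i) /\ (N <= n i)%N,
      trivIset `I_m (fun i => bowen_cball act (F (n i)) (x i) e)
    & 1 <= \sum_(i < m) expR (- s * #|` F (n i)|%:R)].
Proof.
move=> bigE; have : (1%:E < packing_N act F E N e s)%E.
  rewrite ltNge; apply/negP => le1; apply: bigE; exists (fun=> E); split.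
    by move=> x Ex; exists 0%N.
  move=> _; apply: le_lt_trans (packing_pre_le _ _ _ N _ _) _.
  by apply: le_lt_trans le1 _; rewrite ltry.
move=> /ereal_sup_gt[_ [I [x [n [[Ex Nn tx] ->]]]]].
move=> /ereal_sup_gt[_ [A [finA AI] <-]] lt1.
pose r := enum_fset (fset_set A).
have rA i : (i < size r)%N -> A (nth 0%N r i).
  by move=> ir; have := mem_nth 0%N ir; rewrite in_fset_set// inE.
exists (size r), (x \o nth 0%N r), (n \o nth 0%N r); split.
- by move=> i /rA/AI Ii; split; [exact: Ex|exact: Nn].
- move=> i j /= ir jr /tx xij; apply/eqP.
  by rewrite -(nth_uniq 0%N ir jr) ?fset_uniq//; apply/eqP/xij; apply/AI/rA.
- rewrite -lee_fin; apply: le_trans (ltW lt1) _.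
  by rewrite fsbig_finite//= (big_nth 0%N) big_mkord sumEFin.
Qed.

(** As in the Cantor-Bendixson theorem, the points of [E] with a small neighbourhood are caught by
    countably many basic open sets, hence form a small set. *)
Lemma small_core E : ~ small_set E ->
  ~ small_set [set x | E x /\ forall r, 0 < r -> ~ small_set (E `&` ball x r)].
Proof.
set E' := [set x | _] => bigE smallE'; apply: bigE.
have [B /countable_injP[h hinj] [Bopen Bbasis]] := compact_second_countable cptX.
(* [h] is injective on the basis, so [W n] is a single small piece or empty. *)
pose W n := \bigcup_(U in [set U | [/\ B U, h U = n & small_set (E `&` U)]]) (E `&` U).
have Wsmall n : small_set (W n).
  have [[U [BU hU sU]]|noU] :=
    pselect (exists U, [/\ B U, h U = n & small_set (E `&` U)]).
    apply: small_sub sU => x [V [BV hV _] EVx].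
    by rewrite (hinj U V) ?inE// hU hV.
  by apply: small_sub small_set0 => x [U hU _]; apply: noU; exists U.
apply: (@small_sub _ (\bigcup_n (if n is n'.+1 then W n' else E'))); last first.
  by apply: small_bigcup => -[|n].
move=> x Ex; have [E'x|] := pselect (E' x); first by exists 0%N.
move=> /not_andP[//|] /existsNP[r /not_implyP[r0 /contrapT sr]].
have [U [BU Ux] UB] := Bbasis x _ (nbhsx_ballx x r r0).
exists (h U).+1 => //; exists U => //; split => //.
by apply: small_sub sr => y [Ey Uy]; split => //; exact: UB.
Qed.

End small_sets.

Lemma trivIset_itv (R : realType) (c : nat -> R) m : (forall i, c i <= c i.+1) ->
  trivIset `I_m (fun i => [set` `[c i, c i.+1[ ]).
Proof.
move=> cS; have cmono : {homo c : i j / (i <= j)%N >-> i <= j}.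
  by apply: homo_leq => // ? ? ?; exact: le_trans.
move=> i j _ _ [u [/=]]; rewrite !in_itv/= => /andP[iu ui] /andP[ju uj].
case: (ltngtP i j) => // /cmono.
  by move=> /(lt_le_trans ui)/lt_le_trans => /(_ _ ju); rewrite ltxx.
by move=> /(lt_le_trans uj)/lt_le_trans => /(_ _ iu); rewrite ltxx.
Qed.

Lemma itv_bigcup (R : realType) (c : nat -> R) m :
  [set` `[c 0%N, c m[ ] `<=` \bigcup_(i < m) [set` `[c i, c i.+1[ ].
Proof.
elim: m => [|m IH] u /=; first by rewrite in_itv/= => /andP[/le_lt_trans/[apply]]; rewrite ltxx.
rewrite in_itv/= => /andP[c0u ucm]; have [ucm'|cmu] := ltP u (c m).
  have /IH[i /= im cu] : u \in `[c 0%N, c m[ by rewrite in_itv/= c0u.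
  by exists i => //=; exact: ltnW.
by exists m => //=; rewrite in_itv/= cmu.
Qed.

(** * A measure carried by a tree of Bowen balls *)

Section tree_step.
Context {R : realType} {X : pmetricType R} {G : groupType}.
Variables (act : G -> X -> X) (F : nat -> {fset G}) (eps s : R).
Variable g : seq nat -> set X.
Hypotheses (cptX : compact [set: X]) (act_cont : forall h, continuous (act h)).
Hypotheses (eps0 : 0 < eps) (g_split : forall t, g t `<=` \bigcup_n g (n :: t)).

(* A node carries a closed ball of [X] (centre [pt], radius [rds]), the index
   [idx] of the Bowen ball around [pt], a position [cod] in the Souslin scheme
   and the subinterval [cell] of [0, 1[ that the tree assigns to it. *)
Record node := Node { pt : X; idx : nat; rds : R; cod : seq nat; lft : R; wid : R }.

Definition cell (v : node) : set R := [set` `[lft v, lft v + wid v[ ].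

Definition valid (v : node) : Prop := [/\ 0 < rds v, 0 < wid v &
  ~ small_set act F eps s (g (cod v) `&` ball (pt v) (rds v))].

(** [child_ball] nests the metric balls; [child_bowen] puts the Bowen ball of radius [eps / 2]
    around any point of the metric ball of [w] inside the Bowen cell of [w]; [child_wid] caps the
    conditional weight. *)
Record child_of (N : nat) (eta : R) (v w : node) : Prop := ChildOf {
  child_valid : valid w;
  child_pt : g (cod v) (pt w);
  child_cod : exists k, cod w = k :: cod v;
  child_ball : forall y, mdist (pt w) y <= rds w -> mdist (pt v) y <= rds v;
  child_rad : rds w <= eta;
  child_idx : (N <= idx w)%N;
  child_bowen : forall y, mdist (pt w) y <= rds w ->
    bowen_dist act (F (idx w)) (pt w) y <= eps / 2;
  child_wid : wid w <= wid v * expR (- s * #|` F (idx w)|%:R);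
  child_cell : cell w `<=` cell v }.

Definition bowen_cell (v : node) : set X := bowen_cball act (F (idx v)) (pt v) eps.

(** A packing of the core with weight [S >= 1] provides the children. Weights divided by [S] split
    the parent cell, and near each centre some scheme set of the next level is not small. *)
Lemma exists_children N eta v : 0 < eta -> valid v ->
  exists m (w : nat -> node), [/\ forall i, (i < m)%N -> child_of N eta v (w i),
    trivIset `I_m (fun i => bowen_cell (w i)),
    trivIset `I_m (fun i => cell (w i))
  & cell v `<=` \bigcup_(i < m) cell (w i)].
Proof.
move=> eta0 [rv0 wv0 bigv].
have [m [x [n [xn tx S1]]]] := finite_packing N (small_core cptX bigv).
set E := g (cod v) `&` ball (pt v) (rds v) in bigv xn.
have /choice[rk rkP] : forall i, exists rk : R * nat, (i < m)%N ->
    [/\ 0 < rk.1, rk.1 <= eta, rk.1 <= rds v - mdist (pt v) (x i),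
        forall y, mdist (x i) y <= rk.1 ->
          bowen_dist act (F (n i)) (x i) y <= eps / 2
      & ~ small_set act F eps s (g (rk.2 :: cod v) `&` ball (x i) rk.1)].
  move=> i; have [im|mi] := ltnP i m; last by exists (0, 0%N).
  have [[[gx vx] bigx] _] := xn _ im.
  rewrite ballEmdist/= -subr_gt0 in vx.
  have e20 : 0 < eps / 2 by rewrite divr_gt0.
  have /metricType_numDomainType.nbhs_mdistP[d /= d0 xd] :=
    bowen_dist_near act_cont (F (n i)) (x i) e20.
  (* The three bounds give Bowen control, the required size and nesting in the parent ball. *)
  pose r := Num.min (d / 2) (Num.min eta (rds v - mdist (pt v) (x i))).
  have r0 : 0 < r by rewrite !lt_min divr_gt0//= eta0.
  have [k bigk] : exists k, ~ small_set act F eps s (g (k :: cod v) `&` ball (x i) r).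
    apply: contrapT => /forallNP smallk; apply: (bigx _ r0).
    apply: (@small_sub _ _ _ _ _ _ _ _ (\bigcup_k (g (k :: cod v) `&` ball (x i) r))).
      by move=> y [[/g_split[k _ gy] _] xy]; exists k.
    by apply: small_bigcup => k; apply: contrapT; exact: smallk.
  exists (r, k) => _; split => //=; try by rewrite !ge_min lexx ?orbT.
  move=> y xy; apply: ltW; apply: xd => /=; apply: le_lt_trans xy _.
  by rewrite gt_min; apply/orP; left; rewrite ltr_pdivrMr// ltr_pMr// ltr1n.
pose q i := expR (- s * #|` F (n i)|%:R).
pose S := \sum_(i < m) q i.
have S0 : 0 < S by exact: lt_le_trans S1.
pose c i := lft v + wid v * (\sum_(j < i) q j) / S.
have cS i : c i.+1 = c i + wid v * q i / S.
  by rewrite /c big_ord_recr /= mulrDr mulrDl addrA.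
have q0 i : 0 < wid v * q i / S by rewrite divr_gt0// mulr_gt0// expR_gt0.
have c_le i : c i <= c i.+1 by rewrite cS lerDl ltW.
have c0E : c 0%N = lft v by rewrite /c big_ord0 mulr0 mul0r addr0.
have cmE : c m = lft v + wid v by rewrite /c -/S mulfK ?gt_eqF.
pose w i := Node (x i) (n i) (rk i).1 ((rk i).2 :: cod v) (c i) (wid v * q i / S).
have cellE i : cell (w i) = [set` `[c i, c i.+1[ ] by rewrite /cell/= cS.
have cellvE : cell v = [set` `[c 0%N, c m[ ] by rewrite /cell c0E cmE.
exists m, w; split.
- move=> i im; have [r0 reta rv bow bigw] := rkP i im.
  have [[[gx vx] _] Ni] := xn _ im; split => //.
  + by split; [exact: r0|exact: q0|exact: bigw].
  + by exists (rk i).2.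
  + move=> y /= xy; apply: le_trans (metric_triangle _ (x i) _) _.
    by rewrite addrC -lerBrDr; exact: le_trans rv.
  + by rewrite /= ler_pdivrMr// ler_peMr// mulr_ge0 ?expR_ge0// ltW.
  + rewrite cellE cellvE => u /=; rewrite !in_itv/= => /andP[ciu uci].
    have cmono : {homo c : i j / (i <= j)%N >-> i <= j}.
      by apply: homo_leq => // ? ? ?; exact: le_trans.
    by rewrite (le_trans _ ciu) ?cmono// (lt_le_trans uci)// cmono.
- exact: tx.
- have -> : (fun i => cell (w i)) = (fun i => [set` `[c i, c i.+1[ ]).
    exact/funext.
  exact: trivIset_itv.
- by move=> u; rewrite cellvE => /itv_bigcup[i im ciu]; exists i => //; rewrite cellE.
Qed.

End tree_step.

HB.instance Definition _ (R : realType) (X : pmetricType R) := gen_eqMixin (@node R X).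
HB.instance Definition _ (R : realType) (X : pmetricType R) := gen_choiceMixin (@node R X).

Lemma uniform_prob_lebesgue (R : realType) (A : set R) : measurable A ->
  A `<=` `[0, 1] -> uniform_prob (@ltr01 R) A = lebesgue_measure A.
Proof.
move=> mA A01; rewrite /uniform_prob (eq_integral (cst 1%:E)).
  by rewrite integral_cst// mul1e.
move=> x /[!inE] /A01; rewrite /= in_itv/= /uniform_pdf => ->.
by rewrite subr0 invr1.
Qed.

(** Any cluster point of the centres works: each closed ball contains all later centres. *)
Lemma nested_cball (R : realType) (X : pmetricType R) (x : nat -> X) (r : nat -> R) :
    compact [set: X] -> (forall k, 0 <= r k) ->
    (forall k y, mdist (x k.+1) y <= r k.+1 -> mdist (x k) y <= r k) ->
  exists y, forall k, mdist (x k) y <= r k.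
Proof.
move=> cptX r0 nest.
have nested k j y : mdist (x (j + k)%N) y <= r (j + k)%N -> mdist (x k) y <= r k.
  by elim: j => // j IH /nest/IH.
have [|y [_ ycl]] := cptX (x @ \oo) _; first exact: filterT.
exists y => k; rewrite leNgt; apply/negP => lt.
have d0 : 0 < mdist (x k) y - r k by rewrite subr_gt0.
have xk : (x @ \oo) [set z | mdist (x k) z <= r k].
  exists k => // j /= kj; rewrite -(subnK kj) in r0 *; apply: (nested k (j - k)%N).
  by rewrite mdistxx.
have [z [/= xz]] := ycl _ _ xk (nbhsx_ballx y _ d0).
rewrite ballEmdist/= metric_sym ltrBrDr => yz.
have := metric_triangle (x k) z y.
by rewrite leNgt => /negP; apply; apply: le_lt_trans yz; rewrite addrC lerD2l.
Qed.

Lemma closed_mdist_ball (R : realType) (X : pmetricType R) (x : X) (r : R) :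
  closed [set y | mdist x y <= r].
Proof.
rewrite -[X in closed X]setCK; apply: open_closedC; rewrite openE => y /=.
move/negP; rewrite -ltNge -subr_gt0 => d0.
apply/metricType_numDomainType.nbhs_mdistP; exists (mdist x y - r) => // z /= yz.
apply/negP; rewrite -ltNge; have := metric_triangle x z y.
by move: yz; rewrite (metric_sym y z); lra.
Qed.

(** * Branches of the tree and the image measure *)

Section tree.
Context {R : realType} {X : pmetricType R} {G : groupType}.
Variables (act : G -> X -> X) (F : nat -> {fset G}) (eps s s' : R).
Variables (g : seq nat -> set X) (Z : set X).
Hypotheses (cptX : compact [set: X]) (act_cont : forall h, continuous (act h)).
Hypotheses (eps0 : 0 < eps) (s0 : 0 <= s) (gZ : souslin_scheme Z g).
Hypothesis borelZ : borel Z.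
Local Notation node := (@node R X).
Local Notation valid := (valid act F eps s' g).
Local Notation bowen_cell := (bowen_cell act F eps).
Variables (root : node) (arity : node -> nat) (kid : node -> nat -> node).
Variables (loc : node -> R -> nat) (N_ : nat -> nat).
Hypotheses (root_valid : valid root) (root_cod : cod root = [::]).
Hypothesis root_cell : cell root = [set` `[0, 1[ ].
(** Times allowed for the children of a level [k] node: they tend to infinity with [k], and the last
    bound is the loss in Markov's inequality. *)
Hypothesis N_P : forall k n, (N_ k <= n)%N -> [/\ (k <= n)%N,
  0 < #|` F n|%:R :> R & expR (- (s' - s) * #|` F n|%:R) <= k.+1%:R^-1].
Hypothesis kid_child : forall v, valid v -> forall i, (i < arity v)%N ->
  child_of act F eps s' g (N_ (size (cod v))) (size (cod v)).+1%:R^-1 v (kid v i).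
Hypothesis kid_bowen : forall v, valid v ->
  trivIset `I_(arity v) (fun i => bowen_cell (kid v i)).
Hypothesis kid_cell : forall v, valid v ->
  trivIset `I_(arity v) (fun i => cell (kid v i)).
Hypothesis locP : forall v u, valid v -> cell v u ->
  (loc v u < arity v)%N /\ cell (kid v (loc v u)) u.

Fixpoint branch (u : R) (k : nat) : node :=
  if k is k'.+1 then let v := branch u k' in kid v (loc v u) else root.

Let U : set R := [set` `[0, 1[ ].

Lemma branch_valid u k : U u -> valid (branch u k) /\ cell (branch u k) u.
Proof.
move=> Uu; elim: k => [|k [vk ck]] /=; first by rewrite root_cell.
by have [lk ck'] := locP vk ck; split => //; exact: child_valid (kid_child vk lk).
Qed.

Lemma size_cod_branch u k : U u -> size (cod (branch u k)) = k.
Proof.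
move=> Uu; elim: k => [|k IH] /=; first by rewrite root_cod.
have [vk ck] := branch_valid k Uu; have [lk _] := locP vk ck.
by have [n ->] := child_cod (kid_child vk lk); rewrite /= IH.
Qed.

Lemma branch_child u k : U u ->
  child_of act F eps s' g (N_ k) k.+1%:R^-1 (branch u k) (branch u k.+1).
Proof.
move=> Uu; have [vk ck] := branch_valid k Uu; have [lk _] := locP vk ck.
by have := kid_child vk lk; rewrite size_cod_branch.
Qed.

(** Sibling cells are disjoint, so by induction all parameters in one cell follow the same path to
    it. *)
Lemma branch_same u u' k : U u -> U u' -> cell (branch u k) u' ->
  branch u' k = branch u k.
Proof.
move=> Uu Uu'; elim: k => // k IH cu'.
have Ek := IH (child_cell (branch_child k Uu) cu').
have [vk ck] := branch_valid k Uu; have [lk ck'] := locP vk ck.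
have [vk' ckk] := branch_valid k Uu'.
have [lk2 ck2] := locP vk' ckk.
rewrite /= Ek in lk2 ck2 *; congr kid; apply: (kid_cell vk) => //.
by exists u'.
Qed.

Lemma branch_cell u k : U u -> cell (branch u k) `<=` U.
Proof.
move=> Uu; elim: k => [|k IH] /=; first by rewrite root_cell.
by apply: subset_trans IH; exact: child_cell (branch_child k Uu).
Qed.

Definition level k : set node := branch^~ k @` U.

Lemma finite_level k : finite_set (level k).
Proof.
elim: k => [|k IH].
  by apply: (@sub_finite_set _ _ [set root]) => // _ [u _ <-].
apply: (@sub_finite_set _ _ (\bigcup_(v in level k) (kid v @` `I_(arity v)))).
  move=> _ [u Uu <-]; exists (branch u k); first by exists u.
  have [vk ck] := branch_valid k Uu; have [lk _] := locP vk ck.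
  by exists (loc (branch u k) u).
by apply: bigcup_finite => // v _; exact: finite_image.
Qed.

(** Events that depend on the node at one level become finite unions of intervals, hence measurable
    for arbitrary [P]. *)
Lemma branch_preimage k (P : node -> Prop) :
  [set u | U u /\ P (branch u k)] = \bigcup_(v in level k `&` P) @cell R X v.
Proof.
apply/seteqP; split => u /=.
  move=> [Uu Pu]; exists (branch u k); first by split => //; exists u.
  by have [] := branch_valid k Uu.
move=> [_ [[u' Uu' <-] Pu'] cu]; have Uu := branch_cell Uu' cu.
by split => //; rewrite (branch_same Uu').
Qed.

Lemma measurable_cell (v : node) : measurable (cell v).
Proof. exact: measurable_itv. Qed.

Lemma measurable_branch k (P : node -> Prop) :
  measurable [set u | U u /\ P (branch u k)].
Proof.
rewrite branch_preimage; apply: fin_bigcup_measurable.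
  exact/finite_setIl/finite_level.
by move=> v _; exact: measurable_cell.
Qed.

Lemma trivIset_level k : trivIset (level k) (@cell R X).
Proof.
move=> _ _ [u Uu <-] [u' Uu' <-] [x [cu cu']].
have Ux := branch_cell Uu cu.
by rewrite -(branch_same Uu Ux cu) (branch_same Uu' Ux cu').
Qed.

Lemma branch_rad_gt0 u k : U u -> 0 < rds (branch u k).
Proof. by move=> /(branch_valid k)[[]]. Qed.

Lemma exists_limit u : exists x, U u ->
  forall k, mdist (pt (branch u k)) x <= rds (branch u k).
Proof.
have [Uu|nU] := pselect (U u); last by exists point => /nU.
have [||y yP] := @nested_cball _ _ (pt \o branch u) (rds \o branch u) cptX.
- by move=> k; apply/ltW/branch_rad_gt0.
- by move=> k y; exact: child_ball (branch_child k Uu) y.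
- by exists y.
Qed.

Section limit_map.
Variable f : R -> X.
Hypothesis f_limit : forall u, U u ->
  forall k, mdist (pt (branch u k)) (f u) <= rds (branch u k).
Hypothesis f_out : forall u, ~ U u -> f u = point.

Lemma branch_rds_le u k : U u -> rds (branch u k.+1) <= k.+1%:R^-1.
Proof. by move=> /(branch_child k) h; exact: child_rad h. Qed.

(** A centre is only known to lie in the scheme set of its parent; hence the shift by one. *)
Lemma branch_in_scheme u k j : U u -> g (cod (branch u k)) (pt (branch u (j + k).+1)).
Proof.
move=> Uu; have sub : g (cod (branch u (j + k))) `<=` g (cod (branch u k)).
  elim: j => // j; apply: subset_trans.
  have [n /= ->] := child_cod (branch_child (j + k) Uu).
  by have [_ _ h _] := gZ; exact: h.
by apply: sub; exact: child_pt (branch_child (j + k) Uu).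
Qed.

(** The codes along a branch are the prefixes of one sequence, and later centres converge to the
    limit, which therefore lies in the closure of each scheme set on the way. *)
Lemma limit_in u : U u -> Z (f u).
Proof.
move=> Uu; pose nu k := head 0%N (cod (branch u k.+1)).
have codE k : cod (branch u k) = rprefix nu k.
  elim: k => [|k IH]; first exact: root_cod.
  have [n nE] := child_cod (branch_child k Uu).
  by rewrite /= -IH /nu nE.
have [_ _ _ h] := gZ; apply: (h nu) => k _; rewrite -codE => B.
move=> /metricType_numDomainType.nbhs_mdistP[r /= r0 fB].
have [n _ nr] : \forall n \near \oo, n.+1%:R^-1 < r.
  exact: near_infty_natSinv_lt (PosNum r0).
exists (pt (branch u (n + k).+1)); split; first exact: branch_in_scheme.
apply: fB; rewrite /= metric_sym; apply: le_lt_trans (f_limit Uu (n + k).+1) _.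
apply: le_lt_trans (branch_rds_le _ Uu) _; apply: nr => /=; exact: leq_addr.
Qed.

(** Radii tend to 0 and [C] is closed, so the limit is in [C] exactly when the ball at each level
    from 1 on meets [C], a condition on one node at a time. *)
Lemma limit_closed_preimage (C : set X) : closed C -> measurable [set u | U u /\ C (f u)].
Proof.
move=> cC; pose P (v : node) := exists2 c, C c & mdist (pt v) c <= rds v.
have -> : [set u | U u /\ C (f u)] = \bigcap_k [set u | U u /\ P (branch u k.+1)].
  apply/seteqP; split => u /= => [[Uu Cu] k _|h].
    by split => //; exists (f u) => //; exact: (f_limit Uu k.+1).
  have [Uu _] := h 0%N I; split => //; rewrite (closure_id C).1// => B.
  move=> /metricType_numDomainType.nbhs_mdistP[r /= r0 fB].
  have [n _ nr] : \forall n \near \oo, n.+1%:R^-1 < r / 2.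
    by apply: (near_infty_natSinv_lt (PosNum _)); rewrite divr_gt0.
  have [_ [c Cc bc]] := h n I; exists c; split => //; apply: fB => /=.
  apply: le_lt_trans (metric_triangle _ (pt (branch u n.+1)) _) _.
  rewrite metric_sym [ltRHS]splitr.
  have bn : rds (branch u n.+1) < r / 2.
    by apply: le_lt_trans (branch_rds_le _ Uu) _; apply: nr => /=.
  by rewrite ltrD//; apply: (le_lt_trans _ bn) => //; exact: (f_limit Uu n.+1).
by apply: bigcapT_measurable => k; exact: measurable_branch.
Qed.

Lemma measurable_limit : measurable_fun setT (f : measurableTypeR R -> borelType X).
Proof.
apply: (@measurability _ _ _ (borelType X) setT f (@open X : set (set (borelType X)))) => //.
move=> _ [V oV <-]; rewrite setTI.
have mU : measurable U by exact: measurable_itv.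
have mV : measurable [set u | U u /\ V (f u)].
  have -> : [set u | U u /\ V (f u)] = U `\` [set u | U u /\ (~` V) (f u)].
    apply/seteqP; split => u /=; first by move=> [Uu Vu]; split => // -[].
    by move=> [Uu h]; split => //; apply: contrapT => nV; exact: h.
  by apply: measurableD => //; apply: limit_closed_preimage; exact: open_closedC.
(* Outside [U] the map is constant, so the preimage of [V] gains the whole complement of [U] or
   nothing. *)
have [Vp|nVp] := pselect (V point).
  have -> : f @^-1` V = [set u | U u /\ V (f u)] `|` ~` U.
    apply/seteqP; split => u /=.
      by move=> Vu; have [Uu|nU] := pselect (U u); [left|right].
    by move=> [[]//|/f_out ->].
  by apply: measurableU => //; exact: measurableC.
have -> : f @^-1` V = [set u | U u /\ V (f u)] => //.
apply/seteqP; split => u /= => [Vu|[]//]; split => //.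
by apply: contrapT => /f_out fu; apply: nVp; rewrite -fu.
Qed.

Let P0 : probability _ R := uniform_prob (@ltr01 R).

Lemma P0_lebesgue (A : set R) : measurable A -> A `<=` U ->
  P0 A = lebesgue_measure A.
Proof.
move=> mA AU; apply: uniform_prob_lebesgue => // u /AU.
by rewrite /U /= !in_itv/= => /andP[-> /ltW].
Qed.

Lemma P0_U : P0 U = 1%E.
Proof.
rewrite P0_lebesgue//; last exact: measurable_itv.
by rewrite lebesgue_measure_itv/= lte01 oppr0 adde0.
Qed.

Lemma P0_cell v : valid v -> cell v `<=` U -> P0 (cell v) = (wid v)%:E.
Proof.
move=> [_ w0 _] vU; rewrite P0_lebesgue//; last exact: measurable_itv.
by rewrite lebesgue_measure_itv/= lte_fin ltrDl w0 -EFinB addrAC subrr add0r.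
Qed.

Variable mu : probability (borelType X) R.
Hypothesis muE : forall A : set (borelType X), measurable A -> mu A = P0 (f @^-1` A).

Definition good (v : node) : Prop :=
  (mu (bowen_cell v) <= (expR (- s * #|` F (idx v)|%:R))%:E)%E.

Lemma measurable_bowen_cell v : measurable (bowen_cell v : set (borelType X)).
Proof. by apply: closed_borel; exact: closed_bowen_cball. Qed.

(* Markov's inequality: the Bowen cells of siblings are disjoint, so those
   of large mass are few compared with [expR (s' * _)]. *)
Lemma bad_cell v k : level k v ->
  (P0 [set u | cell v u /\ ~ good (branch u k.+1)] <=
   (k.+1%:R^-1)%:E * P0 (cell v))%E.
Proof.
move=> [u0 Uu0 vE]; have [vv _] := branch_valid k Uu0; rewrite vE in vv.
have vU : cell v `<=` U by rewrite -vE; exact: branch_cell.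
have sv : size (cod v) = k by rewrite -vE size_cod_branch.
rewrite P0_cell//; have [_ wv0 _] := vv.
pose D := [set i | (i < arity v)%N /\ ~ good (kid v i)].
have finD : finite_set D by apply: (@sub_finite_set _ _ `I_(arity v)) => // i [].
have Dchild i : D i -> child_of act F eps s' g (N_ k) k.+1%:R^-1 v (kid v i).
  by move=> [iv _]; rewrite -sv; exact: kid_child.
have branchE u : cell v u -> branch u k = v.
  by move=> vu; rewrite -vE; apply: branch_same; rewrite ?vE//; exact: vU.
apply: (@le_trans _ _ (\sum_(i \in D) P0 (cell (kid v i)))%E).
  apply: content_sub_fsum => //.
  - by move=> i _; exact: measurable_cell.
  - have -> : [set u | cell v u /\ ~ good (branch u k.+1)] =
        cell v `&` [set u | U u /\ (fun w => ~ good w) (branch u k.+1)].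
      apply/seteqP; split => u /= [vu]; first by move=> ?; do !split => //; exact: vU.
      by case.
    apply: measurableI; first exact: measurable_cell.
    exact: (measurable_branch k.+1 (fun w => ~ good w)).
  - move=> u [vu /=]; rewrite (branchE _ vu) => bad.
    by have [lv lu] := locP vv vu; exists (loc v u).
(* The relative width is at most [exp (- (s' - s) |F|) * exp (- s |F|)]: the first factor is at most
   [1 / (k + 1)], the second is below the mass of a bad Bowen cell. *)
apply: (@le_trans _ _ (\sum_(i \in D)
    ((wid v / k.+1%:R)%:E * mu (bowen_cell (kid v i))))%E).
  apply: lee_fsum => // i Di; have ch := Dchild i Di.
  rewrite P0_cell//; last 2 first.
  - exact: child_valid ch.
  - by apply: subset_trans vU; exact: child_cell ch.
  apply: le_trans (_ : ((wid v / k.+1%:R) * expR (- s * #|` F (idx (kid v i))|%:R))%:E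
    <= _)%E; last first.
    rewrite EFinM; apply: lee_wpmul2l; first by rewrite lee_fin divr_ge0// ltW.
    by case: Di => _ /negP; rewrite -ltNge => /ltW.
  rewrite lee_fin; apply: le_trans (child_wid ch) _.
  rewrite -mulrA ler_wpM2l ?(ltW wv0)//.
  have [_ _ le] := N_P (child_idx ch).
  rewrite -(subrK s s') opprD mulrDl expRD ler_wpM2r ?expR_ge0//.
rewrite -ge0_mule_fsumr// -measure_fin_bigcup//.
- rewrite mulrC EFinM -[leRHS]mule1; apply: lee_wpmul2l.
    by rewrite lee_fin mulr_ge0// ltW.
  apply: probability_le1; apply: fin_bigcup_measurable => // i _.
  exact: measurable_bowen_cell.
- by apply: sub_trivIset (kid_bowen vv) => i [].
- by move=> i _; exact: measurable_bowen_cell.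
Qed.

Lemma bad_level k :
  (P0 [set u | U u /\ ~ good (branch u k.+1)] <= (k.+1%:R^-1)%:E)%E.
Proof.
have UE : U = \bigcup_(v in level k) cell v.
  have := branch_preimage k (fun=> True); rewrite setIT => <-.
  by apply/seteqP; split => u //= [].
have -> : [set u | U u /\ ~ good (branch u k.+1)] =
    \bigcup_(v in level k) [set u | cell v u /\ ~ good (branch u k.+1)].
  apply/seteqP; split => u /=.
    by rewrite UE => -[[v lv vu] bad]; exists v.
  by move=> [v lv [vu bad]]; split => //; rewrite UE; exists v.
have fin := finite_level k.
have lU v : level k v -> cell v `<=` U by move=> lv u vu; rewrite UE; exists v.
rewrite measure_fin_bigcup//.
- apply: (@le_trans _ _ (\sum_(v \in level k) ((k.+1%:R^-1)%:E * P0 (cell v)))%E).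
    by apply: lee_fsum => // v; exact: bad_cell.
  rewrite -ge0_mule_fsumr// -measure_fin_bigcup//.
  + rewrite -UE -[leRHS]mule1; apply: lee_wpmul2l; first by rewrite lee_fin.
    by apply: probability_le1; exact: measurable_itv.
  + exact: trivIset_level.
  + by move=> v _; exact: measurable_cell.
- move=> v w lv lw [u [[vu _] [wu _]]].
  by apply: (trivIset_level lv lw); exists u.
- move=> v lv.
  have -> : [set u | cell v u /\ ~ good (branch u k.+1)] =
        cell v `&` [set u | U u /\ (fun w => ~ good w) (branch u k.+1)].
    apply/seteqP; split => u /= [vu]; last by case.
    by move=> ?; do !split => //; exact: lU vu.
  apply: measurableI; first exact: measurable_cell.
  exact: (measurable_branch k.+1 (fun w => ~ good w)).
Qed.

(** A region of [X] rather than an event in [U]: the entropy estimate holds at every point that lies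
    in infinitely many of these balls, whether or not a branch ends there. *)
Definition good_region k : set X :=
  \bigcup_(v in level k.+1 `&` good) [set x | mdist (pt v) x <= rds v].

Lemma measurable_good_region k : measurable (good_region k : set (borelType X)).
Proof.
apply: fin_bigcup_measurable; first exact/finite_setIl/finite_level.
by move=> v _; apply: closed_borel; exact: closed_mdist_ball.
Qed.

Lemma mu_good_region k : (1 <= mu (good_region k) + (k.+1%:R^-1)%:E)%E.
Proof.
have mG := measurable_good_region k.
have mf : measurable (f @^-1` good_region k).
  by rewrite -[X in measurable X]setTI; exact: measurable_limit.
pose bad := [set u | U u /\ (fun w => ~ good w) (branch u k.+1)].
have mB : measurable bad by exact: measurable_branch.
rewrite muE//; apply: le_trans (leeD2l _ (bad_level k)).
apply: le_trans (measureU2 P0 mf mB).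
rewrite -[leLHS]P0_U; apply: le_measure; rewrite ?inE.
- exact: measurable_itv.
- exact: measurableU.
move=> u Uu; have [gu|bu] := pselect (good (branch u k.+1)); last by right.
left; exists (branch u k.+1); first by split => //; exists u.
exact: (f_limit Uu k.+1).
Qed.

(** The deficits [1 / (k + 1)] tend to 0, so each tail union has full measure, and continuity from
    above passes this to the upper limit; summability is not at stake. *)
Lemma mu_limsup_good : mu (lim_sup_set good_region) = 1%E.
Proof.
have mG k := measurable_good_region k.
have mGn n : measurable (\bigcup_(k >= n) good_region k : set (borelType X)).
  exact: bigcup_measurable.
have tail n : mu (\bigcup_(k >= n) good_region k) = 1%E.
  apply/eqP; rewrite eq_le probability_le1//=; apply/lee_addgt0Pr => d d0.
  have [m _ md] : \forall m \near \oo, m.+1%:R^-1 < d.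
    exact: near_infty_natSinv_lt (PosNum d0).
  apply: le_trans (mu_good_region (n + m)) _; apply: leeD.
    apply: le_measure; rewrite ?inE//.
    by move=> x Gx; exists (n + m)%N => //=; exact: leq_addr.
  by rewrite lee_fin; apply/ltW/md => /=; exact: leq_addl.
have fin : (mu (\bigcup_(k >= 0) good_region k) < +oo)%E.
  by apply: (@le_lt_trans _ _ 1%E); [exact: probability_le1|exact: ltry].
apply: (cvg_unique _ (lim_sup_set_cvg mu good_region mG fin)) => //.
by apply: cvg_near_cst; apply: nearW => n; exact: tail.
Qed.

Lemma mu_Z : mu Z = 1%E.
Proof.
apply/eqP; rewrite eq_le probability_le1//= muE// -[leLHS]P0_U.
apply: le_measure; rewrite ?inE.
- exact: measurable_itv.
- by rewrite -[X in measurable X]setTI; exact: measurable_limit.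
- by move=> u; exact: limit_in.
Qed.

(** In the metric ball of a good node, the Bowen ball of radius [eps / 2] at [x] inherits the mass
    bound of the Bowen cell. [N_P] sends the indices of these nodes to infinity. *)
Lemma upper_local_rate_good x : lim_sup_set good_region x ->
  (s%:E <= upper_local_rate act F mu x (eps / 2))%E.
Proof.
move=> Gx; apply: le_limn_esup => N; have [k /= Nk [v [[u Uu vE] goodv] vx]] := Gx N I.
have ch := branch_child k Uu; rewrite vE in ch.
have [ki F0 _] := N_P (child_idx ch).
exists (idx v); first exact: leq_trans ki.
rewrite le_entropy_rate//; apply: le_trans goodv; apply: le_measure; rewrite ?inE.
- by apply: open_borel; exact: open_bowen_ball.
- exact: measurable_bowen_cell.
move=> y; rewrite /bowen_ball /bowen_cell /bowen_cball /= => xy.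
apply: le_trans (bowen_dist_triangle _ _ _ x _) _.
by rewrite [leRHS]splitr lerD ?(ltW xy)//; exact: child_bowen ch _ vx.
Qed.

Lemma upper_local_entropy_ge : (s%:E <= upper_local_entropy act F mu Z)%E.
Proof.
have mT : measurable (lim_sup_set good_region : set (borelType X)).
  apply: bigcap_measurable => // n _; apply: bigcup_measurable => k _.
  exact: measurable_good_region.
pose E : set (borelType X) := lim_sup_set good_region `&` Z.
apply: (@integral_ge_of_full _ _ _ mu Z _ _ s E) => //.
- by move=> x; exact: upper_local_entropy_at_ge0.
- exact: measurableI.
- have nZ : mu (~` Z) = 0%E by rewrite probability_setC// mu_Z subee.
  apply/eqP; rewrite eq_le probability_le1//=; last exact: measurableI.
  rewrite -mu_limsup_good -[X in (_ <= X)%E]adde0 -nZ.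
  apply: le_trans (measureU2 mu _ _); last 2 first.
  + exact: measurableI.
  + exact: measurableC.
  apply: le_measure; rewrite ?inE//.
    by apply: measurableU; [exact: measurableI|exact: measurableC].
  by move=> x Tx; have [Zx|nZx] := pselect (Z x); [left|right].
- by move=> x [].
- move=> x [Tx _]; rewrite upper_local_entropy_atE//.
  apply: le_trans (upper_local_rate_good Tx) _; apply: ereal_sup_ubound.
  by exists (eps / 2) => //=; rewrite divr_gt0.
Qed.

End limit_map.
End tree.

(** * The variational principle *)

Section upper_bound.
Context {R : realType} {X : pmetricType R} {G : groupType}.
Variables (act : G -> X -> X) (F : nat -> {fset G}) (Z : set X).
Hypotheses (cptX : compact [set: X]) (act_cont : forall h, continuous (act h)).
Hypotheses (growthF : growth_condition R F) (borelZ : borel Z).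

Lemma exists_measure_of_big (e s s' : R) : 0 < e -> 0 <= s -> s < s' ->
    ~ small_set act F e s' Z ->
  exists2 mu : probability (borelType X) R, mu Z = 1%E &
    (s%:E <= upper_local_entropy act F mu Z)%E.
Proof.
move=> e0 s0 ss' bigZ; have [g gZ] := borel_scheme borelZ.
have [gnil g_split _ _] := gZ.
(* Balls around [point] exhaust the space, so one of them meets [Z] in a set that is not small. *)
have [n bign] : exists n, ~ small_set act F e s' (g [::] `&` ball (point : X) n.+1%:R).
  apply: contrapT => /forallNP smalln; apply: bigZ.
  apply: (@small_sub _ _ _ _ _ _ _ _
    (\bigcup_n (g [::] `&` ball (point : X) n.+1%:R))); last first.
    by apply: small_bigcup => n; apply: contrapT; exact: smalln.
  move=> x Zx; exists (Num.trunc (mdist (point : X) x)) => //.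
  by rewrite gnil ballEmdist; split => //=; exact: truncnS_gt.
pose root : node := Node (point : X) 0 n.+1%:R [::] 0 1.
have root_valid : valid act F e s' g root by split.
have /choice[N_ N_P] k : exists N, forall n, (N <= n)%N -> [/\ (k <= n)%N,
    0 < #|` F n|%:R :> R & expR (- (s' - s) * #|` F n|%:R) <= k.+1%:R^-1].
  have ss0 : 0 < s' - s by rewrite subr_gt0.
  have k0 : 0 < k.+1%:R^-1 :> R by rewrite invr_gt0.
  have [N1 _ N1F] := growth_expR_le growthF ss0 k0.
  have [N2 _ N2F] := growth_card_ge growthF 1.
  exists (maxn k (maxn N1 N2)) => m; rewrite !geq_max => /and3P[km N1m N2m].
  by split => //; [exact: lt_le_trans ltr01 (N2F _ N2m)|exact: N1F].
have /choice[kids kidsP] v : exists mw : nat * (nat -> node), valid act F e s' g v ->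
    [/\ forall i, (i < mw.1)%N ->
          child_of act F e s' g (N_ (size (cod v))) (size (cod v)).+1%:R^-1 v (mw.2 i),
        trivIset `I_mw.1 (fun i => bowen_cell act F e (mw.2 i)),
        trivIset `I_mw.1 (fun i => cell (mw.2 i))
      & cell v `<=` \bigcup_(i < mw.1) cell (mw.2 i)].
  have [vv|nv] := pselect (valid act F e s' g v); last by exists (0%N, fun=> root).
  have eta0 : 0 < (size (cod v)).+1%:R^-1 :> R by rewrite invr_gt0.
  have [m [w mw]] := exists_children cptX act_cont e0 g_split (N_ (size (cod v))) eta0 vv.
  by exists (m, w).
have /choice[loc locP] (vu : node * R) : exists i, valid act F e s' g vu.1 ->
    cell vu.1 vu.2 -> (i < (kids vu.1).1)%N /\ cell ((kids vu.1).2 i) vu.2.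
  have [vv|nv] := pselect (valid act F e s' g vu.1); last by exists 0%N.
  have [cu|nc] := pselect (cell vu.1 vu.2); last by exists 0%N.
  by have [_ _ _ /(_ _ cu)[i im ciu]] := kidsP _ vv; exists i.
pose arity v := (kids v).1; pose kid v := (kids v).2; pose child v u := loc (v, u).
have kid_child v : valid act F e s' g v -> forall i, (i < arity v)%N ->
  child_of act F e s' g (N_ (size (cod v))) (size (cod v)).+1%:R^-1 v (kid v i).
  by move=> /kidsP[].
have kid_bowen v : valid act F e s' g v ->
  trivIset `I_(arity v) (fun i => bowen_cell act F e (kid v i)) by move=> /kidsP[].
have kid_cell v : valid act F e s' g v ->
  trivIset `I_(arity v) (fun i => cell (kid v i)) by move=> /kidsP[].
have childP v u : valid act F e s' g v -> cell v u ->
  (child v u < arity v)%N /\ cell (kid v (child v u)) u := locP (v, u).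
pose br := branch root kid child.
have root_cell : cell root = [set` `[0, 1[ ] by rewrite /cell /= add0r.
have /choice[f fP] (u : R) : exists x, ([set` `[0, 1[ ] u ->
      forall k, mdist (pt (br u k)) x <= rds (br u k)) /\
    (~ [set` `[0, 1[ ] u -> x = point).
  have [Uu|nU] := pselect ([set` `[(0 : R), 1[ ] u); last by exists point.
  by have [x xP] := exists_limit cptX root_valid erefl root_cell kid_child childP u;
    exists x; split => // /(_ Uu).
have f_limit (u : R) := proj1 (fP u).
have f_out (u : R) := proj2 (fP u).
have mf := measurable_limit root_valid erefl root_cell kid_child kid_cell childP
  f_limit f_out.
pose fm : {mfun _ >-> _} := mfun_Sub (mem_set mf).
pose mu := distribution (uniform_prob (@ltr01 R)) fm.
have muE (A : set (borelType X)) : measurable A ->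
  mu A = uniform_prob (@ltr01 R) (f @^-1` A) by [].
exists mu.
  exact: (mu_Z gZ borelZ root_valid erefl root_cell kid_child kid_cell childP
    f_limit f_out muE).
exact: (upper_local_entropy_ge act_cont e0 s0 gZ borelZ root_valid erefl root_cell
  N_P kid_child kid_bowen kid_cell childP f_limit f_out muE).
Qed.

Lemma packing_entropy_le_sup (s : R) : 0 <= s -> (s%:E < packing_entropy act F Z)%E ->
  exists2 mu : probability (borelType X) R, mu Z = 1%E &
    (s%:E <= upper_local_entropy act F mu Z)%E.
Proof.
move=> s0; rewrite packing_entropyE => /ereal_sup_gt[_ [e /= e0 <-] sh].
have [t st th] : exists2 t : R, s < t & (t%:E < packing_entropy_at act F Z e)%E.
  case: (packing_entropy_at act F Z e) sh => [h|_|//]; last first.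
    by exists (s + 1); [rewrite ltrDl|exact: ltry].
  by rewrite lte_fin => sh; exists ((s + h) / 2); rewrite ?lte_fin midf_lt.
(* The tree uses the midpoint exponent: were [Z] small there, its packing measure at [t] would
   vanish, although [t] is below the entropy at [e]. *)
apply: (@exists_measure_of_big e s ((s + t) / 2)) => //; first by rewrite midf_lt.
move=> /(@measure_eq0_small _ _ _ _ _ _ _ t) m0.
have := packing_measure_lt growthF (le_trans s0 (ltW st)) th.
by rewrite m0// midf_lt.
Qed.

End upper_bound.

Theorem theorem1p3 (R : realType) (X : pmetricType R) (G : groupType)
    (act : G -> X -> X) (F : nat -> {fset G}) (Z : set X)
    (cptX : compact [set: X]) (actG : continuous_action act)
    (cntG : countable [set: G]) (infG : infinite_set [set: G])
    (amG : amenable R G) (growthF : growth_condition R F)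
    (borelZ : borel Z) (Z0 : Z !=set0) :
  packing_entropy act F Z =
  ereal_sup [set upper_local_entropy act F mu Z |
    mu in [set mu : probability (borelType X) R | mu Z = 1%E]].
Proof.
have [_ _ act_cont] := actG.
apply/eqP; rewrite eq_le; apply/andP; split; last first.
  by apply: ge_ereal_sup => _ [mu _ <-]; exact: upper_local_entropy_le.
set S := ereal_sup _.
(* A Dirac mass at a point of [Z] keeps the supremum from being over the empty set, where it would
   be [-oo]. *)
have S0 : (0 <= S)%E.
  have [z Zz] := Z0; pose mu : probability (borelType X) R := dirac (z : borelType X).
  apply: (@le_trans _ _ (upper_local_entropy act F mu Z)).
    by apply: integral_ge0 => x _; exact: upper_local_entropy_at_ge0.
  by apply: ereal_sup_ubound; exists mu => //=; rewrite diracE mem_set.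
rewrite leNgt; apply/negP => SE.
have Sfin : S \is a fin_num by rewrite ge0_fin_numE// (lt_le_trans SE)// leey.
have [r Sr rE] : exists2 r : R, (S < r%:E)%E & (r%:E < packing_entropy act F Z)%E.
  rewrite -(fineK Sfin) in SE *.
  case: (packing_entropy act F Z) SE => [h|_|//]; last first.
    by exists (fine S + 1); [rewrite lte_fin ltrDl|exact: ltry].
  rewrite lte_fin => Sh.
  by exists ((fine S + h) / 2); rewrite lte_fin midf_lt.
have r0 : 0 <= r by rewrite -lee_fin (le_trans S0)// ltW.
have [mu muZ] := packing_entropy_le_sup cptX act_cont growthF borelZ r0 rE.
apply/negP; rewrite -ltNge; apply: le_lt_trans Sr.
by apply: ereal_sup_ubound; exists mu.
Qed.
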